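(* Consider the noiseless setting, and assume: (1) $\mathcal{H}_{-\infty}(\mathbf{X})<\infty$; (2) $\sum_{s=0}^{\infty} d(s;\mathbf{X})<\infty$; (3) $\mathcal{R}(\mathbf{X}):=\sup_{s\in\mathbb{N}_+}\mathbb{P}[X_1=X_{1+s}]<1$. Then there is a sequence $\epsilon_n\to 0$ (depending on $\beta$ and the law of $\mathbf X$) such that for all $n$ \[ P^*_{\mathrm{error}}\le 2(1+\epsilon_n)\left\{\beta\wedge \frac{1}{\mathcal{H}_1(\mathbf{X})}\right\}\frac{\log n}{n}, \] with the convention $1/0=\infty$.
   Context: Setting. Let $\mathcal X$ be a finite alphabet; logarithms are to base $|\mathcal X|$. Let $\mathbf X=\{X_i\}_{i\in\mathbb Z}$ be a stationary random process on $\mathcal X$. Fix $\beta>0$; for $n\in\mathbb N$ let $\ell=\ell(n)=\beta\log n$ (rounded to an integer) and $n_\ell:=n-(2\ell-1)$. Let $I(1)\sim\mathrm{Uniform}[n]$ and, conditionally on $I(1)$, let $I(2)$ be uniform on $I(1)+\{-\ell+1,\dots,n-\ell\}$ if $1\le I(1)\le \ell-1$, uniform on $[n]=\{1,\dots,n\}$ if $\ell\le I(1)\le n-\ell+1$, and uniform on $I(1)+\{\ell-n,\dots,\ell-1\}$ if $n-\ell+2\le I(1)\le n$; $(I(1),I(2))$ is independent of $\mathbf X$. The noiseless reads are $X_1^\ell(j):=X_{I(j)}^{I(j)+\ell-1}$, $j=1,2$. The signed overlap is $T:=\max\{0,\ell-(I(2)-I(1))\}$ if $I(2)\ge I(1)$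 and $T:=-\max\{0,\ell-(I(1)-I(2))\}$ if $I(2)<I(1)$; it takes values in $\mathcal T:=\{-(\ell-1),\dots,-1,0,1,\dots,\ell\}$ with $\mathbb P[T=0]=n_\ell/n$ and $\mathbb P[T=t]=1/n$ for $t\neq 0$. Given a finite alphabet $\mathcal Y$ and a Markov kernel $P_{Y_1^\ell\mid X_1^\ell}$ from $\mathcal X^\ell$ to $\mathcal Y^\ell$, the noisy reads $Y_1^\ell(j)$, $j=1,2$, are drawn from this kernel given $X_1^\ell(j)$, conditionally independently given the noiseless reads. A detector is any map $\hat T:\mathcal Y^\ell\times\mathcal Y^\ell\to\mathcal T$; $P_{\mathrm{error}}(\hat T):=\mathbb P[\hat T(Y_1^\ell(1),Y_1^\ell(2))\neq T]$ and $P^*_{\mathrm{error}}:=\min_{\hat T}P_{\mathrm{error}}(\hat T)$. Noiseless setting: $\mathbf X$ is stationary and ergodic and $Y_1^\ell=X_1^\ell$ with probability one. Rényi entropies: for a p.m.f. $P$, $H_\alpha(P)=\frac1{1-\alpha}\log\sum_x P^\alpha(x)$ for $\alpha\ne1$, $H_1(P)=-\sum_xP(x)\log P(x)$, and $H_{-\infty}(P)=-\log\min_{x\in\mathrm{supp}(P)}P(x)$. The order-$\alpha$ Rényi entropy rate is $\mathcal H_\alpha(\mathbf X):=\lim_{t\to\infty}\frac{1}{2t+1}H_\alpha(P_{X_{-t}^t})$; these limits are assumed to exist. Strong mixing coefficient: $d(s;\mathbf X):=\sup\{|\mathbb P[\mathcal F\mid\mathcal E]-\mathbb P[\mathcal F]|: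 i\in\mathbb Z,\ \mathcal E\in\sigma(X_{-\infty}^i),\ \mathcal F\in\sigma(X_{i+s}^\infty)\}$, taken w.l.o.g. to be non-increasing in $s$ (replace by $\sup_{s'\ge s}d(s')$). *)

(* Defs.v *)
From HB Require Import structures.
From mathcomp Require Import all_boot all_order all_algebra.
From mathcomp Require Import all_classical all_reals all_analysis.
Set Implicit Arguments. Unset Strict Implicit. Unset Printing Implicit Defensive.
Import Order.TTheory GRing.Theory Num.Theory.
Import numFieldNormedType.Exports.
Local Open Scope classical_set_scope.
Local Open Scope ring_scope.

Section Model.
Variables (R : realType) (d : measure_display) (Omega : measurableType d)
  (P : probability Omega R) (A : finType) (X : int -> Omega -> A).

Definition Prob (E : set Omega) : R := fine (P E).

Definition logb (x : R) : R := ln x / ln (#|A|%:R).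

(* each X_i is a random variable (finite alphabet: point preimages measurable) *)
Definition is_process : Prop := forall i a, measurable (X i @^-1` [set a]).

Definition cyl (i : int) (k : nat) (w : {ffun 'I_k -> A}) : set Omega :=
  [set om | forall j : 'I_k, X (i + (j : nat)%:Z) om = w j].

Definition stationary : Prop :=
  forall (i : int) (k : nat) (w : {ffun 'I_k -> A}), P (cyl i w) = P (cyl 0 w).

Definition path_of (om : Omega) : int -> A := fun i => X i om.
Definition coord_sigma : set (set (int -> A)) :=
  <<s range (fun ia : int * A => [set f : int -> A | f ia.1 = ia.2]) >>.
Definition shift_invariant (B : set (int -> A)) : Prop :=
  forall f, B f <-> B (fun i => f (i + 1)).
Definition ergodic : Prop :=
  forall B, coord_sigma B -> shift_invariant B ->
    P (path_of @^-1` B) = 0%E \/ P (path_of @^-1` B) = 1%E.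

Definition sigmaX (J : set int) : set (set Omega) :=
  <<s [set X p.1 @^-1` [set p.2] | p in [set p : int * A | J p.1]] >>.

Definition mixing_coef (s : nat) : R :=
  sup [set r | exists (i : int) (E F : set Omega),
        [/\ sigmaX [set j | j <= i] E, sigmaX [set j | i + s%:Z <= j] F,
            0 < Prob E & r = `|Prob (F `&` E) / Prob E - Prob F| ] ].

Definition shannon (T : finType) (p : T -> R) : R :=
  - \sum_(x | 0 < p x) p x * logb (p x).
Definition renyi_minf (T : finType) (p : T -> R) : R :=
  - logb (\big[Num.min/1]_(x | 0 < p x) p x).

Definition window_pmf (t : nat) : {ffun 'I_(t.*2.+1) -> A} -> R :=
  fun w => Prob (cyl (- t%:Z) w).

Definition rate_seq (H : forall T : finType, (T -> R) -> R) (t : nat) : R :=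
  (t.*2.+1)%:R^-1 * H _ (@window_pmf t).

Definition recurrence : R :=
  sup [set Prob [set om | X 1 om = X (1 + s.+1%:Z) om] | s in [set: nat]].

Definition ell (beta : R) (n : nat) : nat :=
  absz (Num.floor (beta * logb n%:R + 2^-1)).

Definition zrange (a b : int) : seq int :=
  if b < a then [::] else [seq a + (k%:Z) | k <- iota 0 (absz (b - a + 1))].

(* support of I(2) given I(1) = i1 *)
Definition supp2 (n l : nat) (i1 : int) : seq int :=
  if (1 <= i1) && (i1 <= l%:Z - 1) then zrange (i1 - l%:Z + 1) (i1 + n%:Z - l%:Z)
  else if (l%:Z <= i1) && (i1 <= n%:Z - l%:Z + 1) then zrange 1 n%:Z
  else zrange (i1 + l%:Z - n%:Z) (i1 + l%:Z - 1).

Definition overlap (l : nat) (i1 i2 : int) : int :=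
  if i1 <= i2 then Num.max 0 (l%:Z - (i2 - i1))
  else - Num.max 0 (l%:Z - (i1 - i2)).

Definition Tset (l : nat) (t : int) : Prop := - (l%:Z - 1) <= t <= l%:Z.

Definition read (l : nat) (i : int) (om : Omega) : {ffun 'I_l -> A} :=
  [ffun j : 'I_l => X (i + (j : nat)%:Z) om].

Definition detector (l : nat) := {ffun 'I_l -> A} -> {ffun 'I_l -> A} -> int.

(* P_error of a detector in the noiseless setting; (I(1), I(2)) independent of X *)
Definition Perr (n l : nat) (Th : detector l) : R :=
  \sum_(i1 <- zrange 1 n%:Z) n%:R^-1 *
    \sum_(i2 <- supp2 n l i1) (size (supp2 n l i1))%:R^-1 *
       Prob [set om | Th (read l i1 om) (read l i2 om) != overlap l i1 i2].

Definition Pstar (n l : nat) : R :=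
  inf [set Perr n Th | Th in [set Th : detector l | forall y1 y2, Tset l (Th y1 y2)]].

End Model.

(* beta /\ 1/h with 1/0 = +oo *)
Definition min_inv (R : realType) (beta h : R) : R :=
  if h == 0 then beta else Num.min beta h^-1.

(* Main.v *)
Require Import Defs.
From HB Require Import structures.
From mathcomp Require Import all_boot all_order all_algebra.
From mathcomp Require Import all_classical all_reals all_analysis.
From mathcomp Require Import zify ring lra.
Set Implicit Arguments.
Unset Strict Implicit.
Unset Printing Implicit Defensive.
Import Order.TTheory GRing.Theory Num.Theory.
Import numFieldNormedType.Exports.
Local Open Scope classical_set_scope.
Local Open Scope ring_scope.

(** The detector declares an overlap of length [t] when a typical word of length
    [M ~ (1/h + o(1)) ln n] at the start of one read recurs [t] letters before the end of the
    other ([h] is the entropy rate in nats). Typical words have probability at most [o(1/n)], so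
    false alarms on disjoint reads cost [O(d(s) + ell * o(1/n))] at gap [s], and summability of
    [d] makes the total negligible. On overlapping reads a wrong alarm forces the process to agree
    with a shifted copy of itself over [M] letters; since [R(X) < 1] and [d(s) -> 0], this has
    probability exponentially small in [M]. There remain the [2 * M] overlaps that are too short
    and the atypical words, whose probability tends to [0].

    Typicality needs only one half of the Shannon-McMillan theorem. Comparison with the product of
    the block laws and a Chebyshev bound give [- ln P(X_1^L) <= L (h + o(1))] with high
    probability; as [- ln P(X_1^L) / L] is bounded (finiteness of the order [-oo] rate) with mean
    tending to [h], it cannot be much below [h] with non-vanishing probability either. *)

(** * Real-valued probabilities, finite unions and partitions *)

Section ProbBasics.
Variables (R : realType) (d : measure_display) (Omega : measurableType d)
  (P : probability Omega R).
Implicit Types E F : set Omega.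

Lemma Prob_ge0 E : 0 <= Prob P E.
Proof. by rewrite fine_ge0 ?measure_ge0. Qed.

Lemma ProbE E : measurable E -> P E = (Prob P E)%:E.
Proof. by move=> mE; rewrite /Prob fineK// fin_num_measure. Qed.

Lemma Prob_setT : Prob P setT = 1.
Proof. by rewrite /Prob probability_setT. Qed.

Lemma Prob_set0 : Prob P set0 = 0.
Proof. by rewrite /Prob measure0. Qed.

Lemma le_Prob E F : measurable E -> measurable F -> E `<=` F ->
  Prob P E <= Prob P F.
Proof.
move=> mE mF EF; rewrite -lee_fin -!ProbE//.
by apply: le_measure; rewrite ?inE.
Qed.

Lemma Prob_le1 E : measurable E -> Prob P E <= 1.
Proof. by move=> mE; rewrite -Prob_setT le_Prob. Qed.

Lemma Prob_setU_le E F : measurable E -> measurable F ->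
  Prob P (E `|` F) <= Prob P E + Prob P F.
Proof.
move=> mE mF; rewrite -lee_fin EFinD -!ProbE//; last exact: measurableU.
exact: measureU2.
Qed.

Lemma Prob_setC E : measurable E -> Prob P (~` E) = 1 - Prob P E.
Proof.
move=> mE; apply: EFin_inj; rewrite -ProbE; last exact: measurableC.
by rewrite probability_setC// ProbE.
Qed.

Lemma measurable_exists d' (U : measurableType d') (T : finType)
    (F : T -> set U) :
  (forall x, measurable (F x)) -> measurable [set u | exists x, F x u].
Proof.
move=> mF; have -> : [set u | exists x, F x u] = \bigcup_(x in [set: T]) F x.
  by apply/seteqP; split => u /= [x]; [exists x|move=> _; exists x].
by apply: fin_bigcup_measurable.
Qed.

Lemma measurable_forall d' (U : measurableType d') (T : finType)
    (F : T -> set U) :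
  (forall x, measurable (F x)) -> measurable [set u | forall x, F x u].
Proof.
move=> mF; have -> : [set u | forall x, F x u] = ~` [set u | exists x, (~` F x) u].
  apply/seteqP; split => u /=; first by move=> h [x]; apply; exact: h.
  by move=> h x; apply: contrapT => nF; apply: h; exists x.
by apply: measurableC; apply: measurable_exists => x; exact: measurableC.
Qed.

Lemma Prob_exists_le (T : finType) (F : T -> set Omega) :
  (forall x, measurable (F x)) ->
  Prob P [set om | exists x, F x om] <= \sum_x Prob P (F x).
Proof.
move=> mF.
have -> : [set u | exists x, F x u] = \big[setU/set0]_(x <- index_enum T) F x.
  rewrite -bigcup_seq; apply/seteqP; split => u /= [x]; first by exists x; rewrite //= mem_index_enum.
  by move=> _; exists x.
elim: (index_enum T) => [|x s IH]; first by rewrite !big_nil Prob_set0.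
rewrite !big_cons; set G := \big[_/_]_(_ <- s) _ in IH *.
have mG : measurable G by apply: bigsetU_measurable => y _.
by rewrite (le_trans (Prob_setU_le (mF x) mG))// lerD2l.
Qed.

Lemma Prob_setU E F : measurable E -> measurable F -> E `&` F = set0 ->
  Prob P (E `|` F) = Prob P E + Prob P F.
Proof.
move=> mE mF EF; apply: EFin_inj; rewrite EFinD -!ProbE//; last exact: measurableU.
by rewrite measureU.
Qed.

Lemma Prob_partition (T : finType) (f : Omega -> T) E :
  measurable E -> (forall x, measurable (f @^-1` [set x])) ->
  Prob P E = \sum_x Prob P (E `&` f @^-1` [set x]).
Proof.
move=> mE mf.
have H (s : seq T) : uniq s -> measurable (E `&` f @^-1` [set` s]) /\
    Prob P (E `&` f @^-1` [set` s]) = \sum_(x <- s) Prob P (E `&` f @^-1` [set x]).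
  elim: s => [_|x s IH /= /andP[xs /IH[ms es]]].
    rewrite big_nil set_nil preimage_set0 setI0; split; first exact: measurable0.
    by rewrite Prob_set0.
  have -> : E `&` f @^-1` [set` x :: s] =
      (E `&` f @^-1` [set x]) `|` (E `&` f @^-1` [set` s]).
    apply/seteqP; split => u /=.
      by rewrite inE => -[Eu /orP[/eqP fu|fu]]; [left|right].
    by move=> [[Eu fu]|[Eu fu]]; split=> //; rewrite inE ?fu ?eqxx ?orbT.
  have mx : measurable (E `&` f @^-1` [set x]) by exact: measurableI.
  split; first exact: measurableU.
  rewrite big_cons Prob_setU ?es//; apply/seteqP; split => // u /= [[_ ->] [_]].
  by rewrite (negbTE xs).
have [_] := H (index_enum T) (index_enum_uniq T).
by move=> <-; congr Prob; apply/seteqP; split => u /=; [rewrite mem_index_enum|case].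
Qed.

End ProbBasics.

(** * Coordinate sigma-algebras, strong mixing and stationarity *)

Section Process.
Variables (R : realType) (d : measure_display) (Omega : measurableType d)
  (P : probability Omega R) (A : finType) (X : int -> Omega -> A).
Local Notation Pr := (Prob P).
Implicit Types (J : set int) (E F : set Omega).

Let gens J := [set X p.1 @^-1` [set p.2] | p in [set p : int * A | J p.1]].

Lemma sigmaX_coord J i a : J i -> sigmaX X J [set om | X i om = a].
Proof. by move=> Ji; apply: sub_sigma_algebra; exists (i, a). Qed.

Lemma sigmaX_setC J E : sigmaX X J E -> sigmaX X J (~` E).
Proof. exact: (@measurableC _ (g_sigma_algebraType (gens J))). Qed.

Lemma sigmaX_setI J E F : sigmaX X J E -> sigmaX X J F -> sigmaX X J (E `&` F).
Proof. exact: (@measurableI _ (g_sigma_algebraType (gens J))). Qed.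

Lemma sigmaX_setT J : sigmaX X J setT.
Proof. exact: (@measurableT _ (g_sigma_algebraType (gens J))). Qed.

Lemma sigmaX_const J (Q : Prop) : sigmaX X J [set om | Q].
Proof.
have [q|nq] := pselect Q.
  by rewrite (_ : [set om | Q] = setT); [exact: sigmaX_setT|apply/seteqP; split].
rewrite (_ : [set om | Q] = ~` setT); first by apply: sigmaX_setC; exact: sigmaX_setT.
by apply/seteqP; split=> om //= /(_ I).
Qed.

Lemma sigmaX_exists J (T : finType) (F : T -> set Omega) :
  (forall x, sigmaX X J (F x)) -> sigmaX X J [set om | exists x, F x om].
Proof. exact: (@measurable_exists _ (g_sigma_algebraType (gens J))). Qed.

Lemma sigmaX_forall J (T : finType) (F : T -> set Omega) :
  (forall x, sigmaX X J (F x)) -> sigmaX X J [set om | forall x, F x om].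
Proof. exact: (@measurable_forall _ (g_sigma_algebraType (gens J))). Qed.

Lemma sigmaX_cyl J i l (w : {ffun 'I_l -> A}) :
  (forall k, (k < l)%N -> J (i + k%:Z)) -> sigmaX X J (cyl X i w).
Proof. by move=> Jl; apply: sigmaX_forall => k; apply: sigmaX_coord; exact: Jl. Qed.

Lemma readE i l om (w : {ffun 'I_l -> A}) : (read X l i om = w) <-> cyl X i w om.
Proof.
split=> [<- k /=|h]; first by rewrite ffunE.
by apply/ffunP => k; rewrite ffunE h.
Qed.

Lemma preimage_read i l (w : {ffun 'I_l -> A}) : read X l i @^-1` [set w] = cyl X i w.
Proof. by apply/seteqP; split=> om /= /readE. Qed.

Lemma sigmaX_read J i l (Q : {ffun 'I_l -> A} -> Prop) :
  (forall k, (k < l)%N -> J (i + k%:Z)) -> sigmaX X J [set om | Q (read X l i om)].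
Proof.
move=> Jl.
have -> : [set om | Q (read X l i om)] =
    [set om | exists w, ([set om | Q w] `&` cyl X i w) om].
  apply/seteqP; split => om /=; first by move=> h; exists (read X l i om); split=> //; apply/readE.
  by move=> [w [/= Qw /readE ->]].
apply: sigmaX_exists => w; apply: sigmaX_setI; [exact: sigmaX_const|exact: sigmaX_cyl].
Qed.

Lemma sigmaX_coord_eq J i j : J i -> J j -> sigmaX X J [set om | X i om = X j om].
Proof.
move=> Ji Jj.
have -> : [set om | X i om = X j om] =
    [set om | exists a, ([set om | X i om = a] `&` [set om | X j om = a]) om].
  by apply/seteqP; split => om /=; [move=> h; exists (X i om)|move=> [a [-> ->]]].
by apply: sigmaX_exists => a; apply: sigmaX_setI; exact: sigmaX_coord.
Qed.

Hypothesis X_process : is_process X.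

Lemma sigmaX_measurable J E : sigmaX X J E -> measurable E.
Proof.
apply: smallest_sub; first exact: sigma_algebra_measurable.
by move=> _ [p _ <-]; exact: X_process.
Qed.

Lemma measurable_read i l (Q : {ffun 'I_l -> A} -> Prop) :
  measurable [set om | Q (read X l i om)].
Proof. by apply: (@sigmaX_measurable setT); exact: sigmaX_read. Qed.

Lemma measurable_read2 i j l l' (Q : {ffun 'I_l -> A} -> {ffun 'I_l' -> A} -> Prop) :
  measurable [set om | Q (read X l i om) (read X l' j om)].
Proof.
have -> : [set om | Q (read X l i om) (read X l' j om)] =
    [set om | exists w, (cyl X i w `&` [set om | Q w (read X l' j om)]) om].
  apply/seteqP; split => om /=; last by move=> [w [/readE <-]].
  by move=> h; exists (read X l i om); split=> //; apply/readE.
apply: measurable_exists => w; apply: measurableI; last exact: measurable_read.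
by apply: (@sigmaX_measurable setT); exact: sigmaX_cyl.
Qed.

Lemma measurable_cyl i l (w : {ffun 'I_l -> A}) : measurable (cyl X i w).
Proof. by apply: (@sigmaX_measurable setT); exact: sigmaX_cyl. Qed.

Lemma Prob_read i l (Q : pred {ffun 'I_l -> A}) :
  Pr [set om | Q (read X l i om)] = \sum_(w | Q w) Pr (cyl X i w).
Proof.
rewrite (@Prob_partition _ _ _ P _ (read X l i)); first last.
- by move=> w; rewrite preimage_read; exact: measurable_cyl.
- exact: (@measurable_read i l (fun w => Q w)).
rewrite [RHS]big_mkcond/=; apply: eq_bigr => w _; rewrite preimage_read.
case: ifPn => Qw.
  by congr Prob; apply/seteqP; split=> om /= => [[]//|h]; split=> //; move/readE: h => ->.
rewrite -(Prob_set0 P); congr Prob; apply/seteqP; split=> om //= [h /readE E].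
by move: h; rewrite E (negbTE Qw).
Qed.

Lemma sum_Prob_cyl i l : \sum_(w : {ffun 'I_l -> A}) Pr (cyl X i w) = 1.
Proof.
rewrite -(@Prob_read i l predT) -[RHS](Prob_setT P); congr Prob.
by apply/seteqP; split.
Qed.

(** The product form avoids conditioning on a null event: if [Pr E = 0], both sides vanish.
    Otherwise the quotient is a member of the set whose [sup] is taken, and 1 bounds that set
    because both probabilities lie in [0, 1]. *)
Lemma mixing_coef_ub (s : nat) (i : int) E F :
  sigmaX X [set j | j <= i] E -> sigmaX X [set j | i + s%:Z <= j] F ->
  `|Pr (F `&` E) - Pr E * Pr F| <= Pr E * mixing_coef P X s.
Proof.
move=> sE sF.
have [mE mF] := (sigmaX_measurable sE, sigmaX_measurable sF).
have := Prob_ge0 P E; rewrite le_eqVlt => /predU1P[E0|E0].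
  rewrite -E0 !mul0r subr0 ger0_norm ?Prob_ge0// E0.
  by apply: le_Prob => //; exact: measurableI.
have -> : Pr (F `&` E) - Pr E * Pr F = Pr E * (Pr (F `&` E) / Pr E - Pr F).
  by field; rewrite gt_eqF.
rewrite normrM (gtr0_norm E0) ler_pM2l//.
apply: ub_le_sup; last by exists i, E, F.
exists 1 => _ [i' [E' [F' [sE' sF' E'0 ->]]]].
have [mE' mF'] := (sigmaX_measurable sE', sigmaX_measurable sF').
have le1 : Pr (F' `&` E') / Pr E' <= 1.
  rewrite ler_pdivrMr// mul1r; by apply: le_Prob => //; exact: measurableI.
have ge0 : 0 <= Pr (F' `&` E') / Pr E' by rewrite divr_ge0 ?Prob_ge0.
have := Prob_ge0 P F'; have := Prob_le1 P mF'.
by rewrite ler_norml; lra.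
Qed.

Lemma mixing_coef_ge0 s : 0 <= mixing_coef P X s.
Proof.
have := mixing_coef_ub (@sigmaX_setT [set j | j <= 0]) (@sigmaX_setT [set j | 0 + s%:Z <= j]).
by rewrite Prob_setT !mul1r; apply: le_trans.
Qed.

Lemma Prob_setI_mixing (s : nat) (i : int) E F :
  sigmaX X [set j | j <= i] E -> sigmaX X [set j | i + s%:Z <= j] F ->
  Pr (E `&` F) <= Pr E * (Pr F + mixing_coef P X s).
Proof.
move=> sE sF; have := mixing_coef_ub sE sF; rewrite setIC ler_norml => /andP[_].
by rewrite lerBlDl mulrDr.
Qed.

Hypothesis X_stationary : stationary P X.

Lemma Prob_cyl i l (w : {ffun 'I_l -> A}) : Pr (cyl X i w) = Pr (cyl X 0 w).
Proof. by rewrite /Prob X_stationary. Qed.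

Lemma Prob_read_stationary i j l (Q : {ffun 'I_l -> A} -> Prop) :
  Pr [set om | Q (read X l i om)] = Pr [set om | Q (read X l j om)].
Proof.
have H k : Pr [set om | Q (read X l k om)] = \sum_(w | `[< Q w >]) Pr (cyl X 0 w).
  under eq_bigr do rewrite -(Prob_cyl k).
  rewrite -Prob_read; congr Prob; apply/seteqP; split=> om /=; first by move=> h; apply/asboolP.
  by move/asboolP.
by rewrite !H.
Qed.

Lemma Prob_coord_eq i j : Pr [set om | X i om = X (i + j%:Z) om] = Pr [set om | X 1 om = X (1 + j%:Z) om].
Proof.
have H k : [set om | X k om = X (k + j%:Z) om] =
   [set om | (fun w : {ffun 'I_j.+1 -> A} => w ord0 = w ord_max) (read X j.+1 k om)].
  by apply/seteqP; split=> om /=; rewrite !ffunE addr0.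
by rewrite !H; exact: (Prob_read_stationary _ _ (fun w : {ffun 'I_j.+1 -> A} => w ord0 = w ord_max)).
Qed.

Lemma Prob_coord_eq_le i j : (0 < j)%N ->
  Pr [set om | X i om = X (i + j%:Z) om] <= recurrence P X.
Proof.
case: j => // j _; rewrite Prob_coord_eq; apply: ub_le_sup; last by exists j.
exists 1 => _ [s _ <-]; apply: Prob_le1.
by apply: (@sigmaX_measurable setT); exact: sigmaX_coord_eq.
Qed.

Lemma Prob_coord i a : Pr [set om | X i om = a] = Pr [set om | X 1 om = a].
Proof.
have H k : [set om | X k om = a] =
   [set om | (fun w : {ffun 'I_1 -> A} => w ord0 = a) (read X 1 k om)].
  by apply/seteqP; split=> om /=; rewrite !ffunE addr0.
by rewrite !H; exact: (Prob_read_stationary _ _ (fun w : {ffun 'I_1 -> A} => w ord0 = a)).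
Qed.

(** At least one of X_i = X_(i+1), X_i <> a, X_(i+1) <> a always holds, so 1 <= R + 2 (1 -
    Pr[X_i = a]) with R the recurrence. *)
Lemma Prob_coord_le i a : Pr [set om | X i om = a] <= (1 + recurrence P X) / 2.
Proof.
have m k b : measurable [set om | X k om = b].
  by apply: (@sigmaX_measurable setT); exact: sigmaX_coord.
have mE : measurable [set om | X i om = X (i + 1) om].
  by apply: (@sigmaX_measurable setT); exact: sigmaX_coord_eq.
have h1 : Pr [set om | X i om = X (i + 1) om] <= recurrence P X by exact: (@Prob_coord_eq_le i 1).
have : Pr setT <= Pr ([set om | X i om = X (i + 1) om] `|`
    (~` [set om | X i om = a] `|` ~` [set om | X (i + 1) om = a])).
  apply: le_Prob => //; last first.
    move=> om _ /=; have [->|] := pselect (X i om = a); last by right; left.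
    by have [->|] := pselect (X (i + 1) om = a); [left|right; right].
  by apply: measurableU => //; apply: measurableU; exact: measurableC.
move=> /le_trans /(_ (Prob_setU_le _ mE _)) => /(_ ltac:(by apply: measurableU; exact: measurableC)).
have := Prob_setU_le P (measurableC (m i a)) (measurableC (m (i + 1) a)).
rewrite !Prob_setC// !(Prob_coord _ a) Prob_setT; lra.
Qed.

End Process.

(** * Repetition of a long word at a nonzero shift *)

Section Repetition.
Variables (R : realType) (d : measure_display) (Omega : measurableType d)
  (P : probability Omega R) (A : finType) (X : int -> Omega -> A).
Local Notation Pr := (Prob P).
Hypotheses (X_process : is_process X) (X_stationary : stationary P X).
Hypothesis recurrence_le1 : recurrence P X <= 1.

(* Sampling every [2 * g] steps leaves a gap of at least [g] between the new pair and what it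
   is compared with: for [s <= g] the whole pair lies ahead of the past, for [s > g] only its
   second element does. *)
Lemma Prob_repetition_sampled (g s K : nat) (a : int) : (0 < s)%N ->
  Pr [set om | forall j : 'I_K,
       X (a + (2 * g * j)%N%:Z) om = X (a + (2 * g * j)%N%:Z + s%:Z) om]
    <= ((1 + recurrence P X) / 2 + mixing_coef P X g) ^+ K.
Proof.
move=> s0; set rho := _ + _.
pose E K := [set om | forall j : 'I_K,
  X (a + (2 * g * j)%N%:Z) om = X (a + (2 * g * j)%N%:Z + s%:Z) om].
have sE K' (J : set int) : (forall j, (j < K')%N -> J (a + (2 * g * j)%N%:Z) /\
    J (a + (2 * g * j)%N%:Z + s%:Z)) -> sigmaX X J (E K').
  move=> h; apply: sigmaX_forall => j; have [h1 h2] := h _ (ltn_ord j).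
  exact: sigmaX_coord_eq.
have mE K' : measurable (E K') by apply: (sigmaX_measurable X_process); exact: (sE _ setT).
rewrite -[X in Pr X]/(E K); elim: K => [|K IH].
  by rewrite expr0; exact: Prob_le1.
pose p := a + (2 * g * K)%N%:Z.
pose F := [set om | X p om = X (p + s%:Z) om].
have mF : measurable F.
  by apply: (sigmaX_measurable X_process); exact: (@sigmaX_coord_eq _ _ _ X setT).
have EF : E K.+1 `<=` E K `&` F.
  move=> om /= h; split; last exact: (h ord_max).
  by move=> j; exact: (h (widen_ord (leqnSn K) j)).
have mEF : measurable (E K `&` F) by exact: measurableI.
apply: (le_trans (le_Prob _ _ _ EF)) => //.
rewrite exprSr; apply: (@le_trans _ _ (Pr (E K) * rho)); last first.
  rewrite ler_wpM2r// /rho addr_ge0 ?mixing_coef_ge0// divr_ge0// addr_ge0//.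
  exact: le_trans (Prob_ge0 P _) (Prob_coord_eq_le X_process X_stationary 0 s0).
have [sg|gs] := leqP s g.
  have E1 : sigmaX X [set j | j <= p - g%:Z] (E K).
    apply: sE => j jK /=; rewrite /p; have gj : (2 * g * j + 2 * g <= 2 * g * K)%N by nia.
  by split; lia.
  have F1 : sigmaX X [set j | p - g%:Z + g%:Z <= j] F.
    by apply: sigmaX_coord_eq => /=; lia.
  apply: (le_trans (Prob_setI_mixing _ _ E1 F1)) => //.
  rewrite ler_wpM2l ?Prob_ge0// lerD2r.
  apply: (le_trans (Prob_coord_eq_le X_process X_stationary p s0)).
  by rewrite ler_pdivlMr//; have := recurrence_le1; lra.
have mX q x : measurable (X q @^-1` [set x]) by exact: X_process.
(* Here s > g, so the letter x at position p may join the past. Given x, agreement is the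
   single-letter event X_(p+s) = x, and [Prob_coord_le] replaces the recurrence bound. *)
rewrite (Prob_partition _ mEF (mX p)) (Prob_partition _ (mE K) (mX p)) mulr_suml.
apply: ler_sum => x _.
have E1 : sigmaX X [set j | j <= p + s%:Z - g%:Z] (E K `&` X p @^-1` [set x]).
  apply: sigmaX_setI; last by apply: sigmaX_coord => /=; lia.
  apply: sE => j jK /=; rewrite /p; have gj : (2 * g * j + 2 * g <= 2 * g * K)%N by nia.
  by split; lia.
have F1 : sigmaX X [set j | p + s%:Z - g%:Z + g%:Z <= j] [set om | X (p + s%:Z) om = x].
  by apply: sigmaX_coord => /=; lia.
have := Prob_setI_mixing P X_process E1 F1.
set u := Pr _; set v := Pr _; move=> h; apply: (@le_trans _ _ u).
  apply: le_Prob; [exact: measurableI|apply: measurableI; [exact: measurableI|exact: (mX _ x)]|].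
  by move=> om [[h1 /= h2] h3]; split; [split|rewrite /= -h2].
apply: (le_trans h); rewrite ler_wpM2l ?Prob_ge0// lerD2r.
exact: Prob_coord_le.
Qed.

(** Keeping only the offsets [2 * g * j] with j < K, all below [M], enlarges the event to the
    sampled one. Agreement is symmetric, so a < b may be assumed. *)
Lemma Prob_repetition (g K M : nat) (a b : int) : (2 * g * K <= M)%N -> a != b ->
  (0 < g)%N ->
  Pr [set om | forall r : 'I_M, X (a + (r : nat)%:Z) om = X (b + (r : nat)%:Z) om]
    <= ((1 + recurrence P X) / 2 + mixing_coef P X g) ^+ K.
Proof.
move=> KM + g0; wlog ab : a b / a < b => [hw ab|_].
  have [lt|gt|eq] := ltgtP a b; first exact: hw; last by rewrite eq eqxx in ab.
  rewrite (_ : [set om | _] = [set om | forall r : 'I_M, X (b + (r : nat)%:Z) om = X (a + (r : nat)%:Z) om]).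
    by apply: hw => //; rewrite eq_sym.
  by apply/seteqP; split => om /= h r.
pose s := absz (b - a).
have bE : b = a + s%:Z by rewrite /s; lia.
have s0 : (0 < s)%N by rewrite /s; lia.
apply: le_trans (Prob_repetition_sampled g K a s0).
have msets (T : finType) (f h : T -> int) : measurable [set om | forall r : T, X (f r) om = X (h r) om].
  apply: (sigmaX_measurable X_process (J := setT)); apply: sigmaX_forall => r.
  exact: sigmaX_coord_eq.
apply: le_Prob; [exact: msets|exact: msets|].
move=> om /= h j.
have jM : (2 * g * j < M)%N.
  by apply: leq_trans KM; rewrite ltn_pmul2l ?muln_gt0.
by have := h (Ordinal jM); rewrite /= bE addrAC.
Qed.

End Repetition.

(** * Sums over distances between integers *)

Section DistanceSums.
Variable R : realType.

(** At most two points, [c + k] and [c - k], lie at distance [k] from [c], and the list has no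
    repetition. *)
Lemma sum_dist_le (s : seq int) (c : int) (K : nat) (G : nat -> R) :
  uniq s -> (forall k, 0 <= G k) ->
  (forall z, z \in s -> (absz (z - c) < K)%N) ->
  \sum_(z <- s) G (absz (z - c)) <= 2 * \sum_(k < K) G k.
Proof.
move=> us G0 sK.
have -> : \sum_(z <- s) G (absz (z - c)) =
    \sum_(z <- s) \sum_(k < K) (if absz (z - c) == k :> nat then G k else 0).
  rewrite big_seq [RHS]big_seq; apply: eq_bigr => z zs.
  by rewrite -big_mkcond/= (big_pred1 (Ordinal (sK _ zs)))// => k; rewrite eq_sym.
rewrite exchange_big/= mulr_sumr; apply: ler_sum => k _.
rewrite -big_mkcond/= big_const_seq iter_addr addr0 -[leLHS]mulr_natl ler_wpM2r//.
rewrite (ler_nat R _ 2) -size_filter.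
apply: (@uniq_leq_size _ _ [:: c + k%:Z; c - k%:Z]); first exact: filter_uniq.
by move=> z; rewrite mem_filter !inE => /andP[/eqP zk _]; apply/orP; lia.
Qed.

Lemma sum_ord_dist_le (N : nat) (i : 'I_N) (G : nat -> R) :
  (forall k, 0 <= G k) ->
  \sum_(j < N) G (absz (j%:Z - i%:Z)) <= 2 * \sum_(k < N) G k.
Proof.
move=> G0.
rewrite -(big_map (fun j : 'I_N => (j : nat)%:Z) xpredT (fun z => G (absz (z - i%:Z)))).
apply: sum_dist_le => // [|_ /mapP[j _ ->]].
  by rewrite map_inj_uniq ?index_enum_uniq// => x y [] /val_inj.
by have := (ltn_ord i, ltn_ord j) => -[]; lia.
Qed.

End DistanceSums.

(** * Words cut into consecutive blocks *)

Section Blocks.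
Variables (A : finType) (N k : nat).

Lemma block_subproof (i : 'I_N) (j : 'I_k) : (i * k + j < N * k)%N.
Proof.
apply: (@leq_trans (i * k + k)); first by rewrite ltn_add2l.
by rewrite -mulSnr leq_mul2r ltn_ord orbT.
Qed.

Definition block (w : {ffun 'I_(N * k) -> A}) (i : 'I_N) : {ffun 'I_k -> A} :=
  [ffun j => w (Ordinal (block_subproof i j))].

Lemma block_inj (w w' : {ffun 'I_(N * k) -> A}) : block w =1 block w' -> w = w'.
Proof.
move=> ww'; apply/ffunP => m.
have k0 : (0 < k)%N by rewrite lt0n; apply/eqP => k0; have := ltn_ord m; rewrite [X in (_ < _ * X)%N]k0 muln0.
have mN : (m %/ k < N)%N by rewrite ltn_divLR.
have mk : (m %% k < k)%N by rewrite ltn_mod.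
move/ffunP: (ww' (Ordinal mN)) => /(_ (Ordinal mk)); rewrite !ffunE.
by rewrite (_ : Ordinal _ = m)//; apply: val_inj; rewrite /= -divn_eq.
Qed.

(** Cutting into blocks is injective, so the sum is part of the total mass of the product law on
    [N]-tuples of blocks, which is 1. *)
Lemma sum_prod_block_le1 (R : realType) (p : {ffun 'I_k -> A} -> R) :
  (forall v, 0 <= p v) -> \sum_v p v = 1 ->
  \sum_(w : {ffun 'I_(N * k) -> A}) \prod_(i < N) p (block w i) <= 1.
Proof.
move=> p0 p1.
pose F (w : {ffun 'I_(N * k) -> A}) := [ffun i => block w i].
have Finj : injective F.
  by move=> w w' /ffunP ww'; apply: block_inj => i; have := ww' i; rewrite !ffunE.
have -> : \sum_(w : {ffun 'I_(N * k) -> A}) \prod_(i < N) p (block w i) =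
    \sum_(f in F @: [set: {ffun 'I_(N * k) -> A}]%SET) \prod_(i < N) p (f i).
  rewrite big_imset/=; last by move=> ? ? _ _; exact: Finj.
  by apply: eq_big => [w|w _]; rewrite ?inE//; apply: eq_bigr => i _; rewrite ffunE.
apply: (@le_trans _ _ (\sum_(f : {ffun 'I_N -> {ffun 'I_k -> A}}) \prod_(i < N) p (f i))); last first.
  by rewrite -(bigA_distr_bigA (fun _ v => p v)) big1.
rewrite big_mkcond/=; apply: ler_sum => f _.
by case: ifP => // _; apply: prodr_ge0.
Qed.

End Blocks.

(** * Covariances of block functions and Chebyshev's inequality *)

Section BlockVariance.
Variables (R : realType) (d : measure_display) (Omega : measurableType d)
  (P : probability Omega R) (A : finType) (X : int -> Omega -> A).
Local Notation Pr := (Prob P).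
Hypotheses (X_process : is_process X) (X_stationary : stationary P X).
Local Notation dm := (mixing_coef P X).

Lemma block_read N k om (i : 'I_N) :
  block (read X (N * k) 0 om) i = read X k (i * k)%N%:Z om.
Proof. by apply/ffunP => j; rewrite !ffunE /= add0r PoszD. Qed.

(** Grouping the words by the values of two of their blocks leaves the joint law of these blocks,
    which mixing controls. *)
Lemma sum_block2 N k (i j : 'I_N) (phi : {ffun 'I_k -> A} -> {ffun 'I_k -> A} -> R) :
  \sum_(w : {ffun 'I_(N * k) -> A}) Pr (cyl X 0 w) * phi (block w i) (block w j) =
  \sum_u \sum_v Pr (cyl X (j * k)%N%:Z v `&` cyl X (i * k)%N%:Z u) * phi u v.
Proof.
pose q (w : {ffun 'I_(N * k) -> A}) := (block w i, block w j).
rewrite (partition_big q xpredT)//= pair_big/=; apply: eq_bigr => -[u v] _ /=.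
transitivity (\sum_(w | q w == (u, v)) Pr (cyl X 0 w) * phi u v).
  by apply: eq_bigr => w /eqP[-> ->].
rewrite -mulr_suml -Prob_read//; congr (Pr _ * _).
apply/seteqP; split => om /=; rewrite /q !block_read.
  by move=> /eqP[/readE ? /readE].
by move=> [/readE -> /readE ->].
Qed.

Variables (k : nat) (f : {ffun 'I_k -> A} -> R) (B : R).
Hypotheses (k_gt0 : (0 < k)%N) (f_le : forall v, `|f v| <= B)
  (f_mean0 : \sum_v Pr (cyl X 0 v) * f v = 0).

Let V : R := #|{ffun 'I_k -> A}|%:R.

Let B_ge0 (v : {ffun 'I_k -> A}) : 0 <= B.
Proof. exact: le_trans (f_le v). Qed.

(** As [f] is centred, the product law can be subtracted from the joint law at no cost; mixing
    bounds the difference by [p u * dm (j - i)]. The distance from the end of block i to the start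
    of block j is (j - i - 1) k + 1 >= j - i. The factor [V] comes from summing over v. *)
Lemma block_cov_lt N (i j : 'I_N) : (i < j)%N ->
  \sum_(w : {ffun 'I_(N * k) -> A}) Pr (cyl X 0 w) * (f (block w i) * f (block w j))
    <= B ^+ 2 * V * dm (j - i).
Proof.
move=> ij; rewrite (sum_block2 i j (fun u v => f u * f v)).
pose p (v : {ffun 'I_k -> A}) := Pr (cyl X 0 v).
have -> : \sum_u \sum_v Pr (cyl X (j * k)%N%:Z v `&` cyl X (i * k)%N%:Z u) * (f u * f v) =
   \sum_u \sum_v (Pr (cyl X (j * k)%N%:Z v `&` cyl X (i * k)%N%:Z u) - p u * p v) * (f u * f v).
  apply: eq_bigr => u _; apply/eqP; rewrite -subr_eq0 -sumrB.
  have -> : \sum_(v | true) (Pr (cyl X (j * k)%N%:Z v `&` cyl X (i * k)%N%:Z u) * (f u * f v) -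
     (Pr (cyl X (j * k)%N%:Z v `&` cyl X (i * k)%N%:Z u) - p u * p v) * (f u * f v)) =
     p u * f u * \sum_v p v * f v.
    by rewrite mulr_sumr; apply: eq_bigr => v _; ring.
  by rewrite f_mean0 mulr0.
apply: (@le_trans _ _ (\sum_(u : {ffun 'I_k -> A}) \sum_(v : {ffun 'I_k -> A}) p u * dm (j - i) * B ^+ 2)).
  apply: ler_sum => u _; apply: ler_sum => v _.
  apply: (le_trans (ler_norm _)); rewrite !normrM.
  apply: ler_pM => //.
    rewrite /p -(Prob_cyl X_stationary (i * k)%N%:Z u) -(Prob_cyl X_stationary (j * k)%N%:Z v).
    apply: (@mixing_coef_ub _ _ _ P _ X X_process (j - i) ((i * k)%N%:Z + k%:Z - 1)).
      by apply: sigmaX_cyl => m mk /=; lia.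
    apply: sigmaX_cyl => m mk /=.
    have : (i * k + (j - i) * k = j * k)%N by rewrite -mulnDl subnKC// ltnW.
    have : (j - i <= (j - i) * k)%N by rewrite leq_pmulr.
    have : (k <= (j - i) * k)%N by rewrite leq_pmull// subn_gt0.
    have : ((j - i) + k <= (j - i) * k + 1)%N by have : (0 < j - i)%N; [rewrite subn_gt0|nia].
    by lia.
  by rewrite expr2; apply: ler_pM.
under eq_bigr do rewrite sumr_const -mulr_natr -!mulrA.
by rewrite -mulr_suml sum_Prob_cyl// mul1r le_eqVlt; apply/orP; left; apply/eqP; rewrite /V; ring.
Qed.

(** Written as a function of the distance alone, to be summed by [sum_ord_dist_le]; the indicator
    carries the diagonal, where only |f| <= B is used. *)
Lemma block_cov N (i j : 'I_N) :
  \sum_(w : {ffun 'I_(N * k) -> A}) Pr (cyl X 0 w) * (f (block w i) * f (block w j))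
    <= B ^+ 2 * ((absz (j%:Z - i%:Z) == 0%N)%:R + V * dm (absz (j%:Z - i%:Z))).
Proof.
have [lt|lt|/val_inj <-] := ltngtP i j.
- rewrite (_ : absz (j%:Z - i%:Z) = j - i)%N; last by lia.
  rewrite (_ : (j - i == 0)%N = false); last by lia.
  by rewrite add0r mulrA; exact: block_cov_lt.
- rewrite (_ : absz (j%:Z - i%:Z) = i - j)%N; last by lia.
  rewrite (_ : (i - j == 0)%N = false); last by lia.
  rewrite add0r mulrA; under eq_bigr do rewrite [f _ * f _]mulrC.
  exact: block_cov_lt.
rewrite subrr absz0 eqxx mulrDr mulr1 -[leLHS]addr0 lerD//; last first.
  by rewrite mulr_ge0 ?sqr_ge0// mulr_ge0 ?mixing_coef_ge0.
rewrite -[leRHS]mul1r -(sum_Prob_cyl P X_process 0 (N * k)) mulr_suml.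
apply: ler_sum => w _; rewrite ler_wpM2l ?Prob_ge0//.
by apply: (le_trans (ler_norm _)); rewrite normrM expr2; apply: ler_pM.
Qed.

(** Chebyshev: the second moment of the block sum is a double sum of covariances. Each row is at
    most B^2 (2 + 2 V D) by summability of the mixing coefficients, so the moment is linear in N,
    against the squared threshold (N delta)^2. *)
Lemma block_sum_tail (D delta : R) N :
  (forall n, \sum_(s < n) dm s <= D) -> 0 < delta -> (0 < N)%N ->
  \sum_(w : {ffun 'I_(N * k) -> A} | N%:R * delta < \sum_(i < N) f (block w i))
    Pr (cyl X 0 w) <= B ^+ 2 * (2 + 2 * V * D) / (N%:R * delta ^+ 2).
Proof.
move=> dD delta0 N0.
have Nd : 0 < N%:R * delta by rewrite mulr_gt0// ltr0n.
have V0 : 0 <= V by [].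
suff : (N%:R * delta) ^+ 2 * \sum_(w : {ffun 'I_(N * k) -> A} | N%:R * delta < \sum_(i < N) f (block w i))
    Pr (cyl X 0 w) <= N%:R * (B ^+ 2 * (2 + 2 * V * D)).
  have N0' : (0 : R) < N%:R by rewrite ltr0n.
  rewrite ler_pdivlMr ?mulr_gt0 ?exprn_gt0// => h.
  by rewrite -(ler_pM2l N0'); apply: le_trans h; rewrite le_eqVlt; apply/orP; left; apply/eqP; ring.
apply: (@le_trans _ _ (\sum_(w : {ffun 'I_(N * k) -> A}) Pr (cyl X 0 w) * (\sum_(i < N) f (block w i)) ^+ 2)).
  rewrite mulr_sumr big_mkcond/=; apply: ler_sum => w _; case: ifPn => [h|_]; last first.
    by rewrite mulr_ge0 ?Prob_ge0 ?sqr_ge0.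
  by rewrite mulrC ler_wpM2l ?Prob_ge0// ler_sqr ?nnegrE ?ltW// (lt_trans Nd).
have -> : \sum_(w : {ffun 'I_(N * k) -> A}) Pr (cyl X 0 w) * (\sum_(i < N) f (block w i)) ^+ 2 =
   \sum_(i < N) \sum_(j < N) \sum_(w : {ffun 'I_(N * k) -> A})
     Pr (cyl X 0 w) * (f (block w i) * f (block w j)).
  under [RHS]eq_bigr do rewrite exchange_big/=.
  rewrite exchange_big/=; apply: eq_bigr => w _.
  rewrite expr2 mulr_suml mulr_sumr; apply: eq_bigr => i _.
  by rewrite !mulr_sumr. 
apply: (@le_trans _ _ (\sum_(i < N) B ^+ 2 * (2 + 2 * V * D))); last first.
  by rewrite sumr_const card_ord [leRHS]mulr_natl.
apply: ler_sum => i _; apply: le_trans; first by apply: ler_sum => j _; exact: block_cov.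
rewrite -mulr_sumr ler_wpM2l ?sqr_ge0//.
apply: le_trans.
  apply: (@sum_ord_dist_le _ _ i (fun s => (s == 0%N)%:R + V * dm s)) => s.
  by rewrite addr_ge0// mulr_ge0 ?mixing_coef_ge0.
rewrite big_split/= -mulr_sumr mulrDr; apply: lerD; last first.
  have -> : 2 * V * D = 2 * (V * D) by ring.
  by rewrite ler_pM2l// ler_wpM2l//; exact: dD.
rewrite -[leRHS]mulr1 (ler_pM2l (ltr0n R 2)); case: (N) => [|N']; first by rewrite big_ord0.
by rewrite big_ord_recl eqxx big1 ?addr0.
Qed.

End BlockVariance.

(** * Entropy of words and the two tails of - ln P(X_1^L) *)

Section WordEntropy.
Variables (R : realType) (d : measure_display) (Omega : measurableType d)
  (P : probability Omega R) (A : finType) (X : int -> Omega -> A).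
Local Notation Pr := (Prob P).
Hypotheses (X_process : is_process X) (X_stationary : stationary P X).
Local Notation dm := (mixing_coef P X).
Local Notation p w := (Pr (cyl X 0 w)).

(** Measured in nats; null words contribute nothing because of the factor [p w]. *)
Definition word_entropy (L : nat) : R :=
  \sum_(w : {ffun 'I_L -> A}) p w * - ln (p w).

Lemma neg_ln_Prob_ge0 E : measurable E -> 0 <= - ln (Pr E).
Proof. by move=> mE; rewrite oppr_ge0 ln_le0// Prob_le1. Qed.

Lemma word_entropy_ge0 L : 0 <= word_entropy L.
Proof.
apply: sumr_ge0 => w _; rewrite mulr_ge0 ?Prob_ge0// neg_ln_Prob_ge0//.
exact: measurable_cyl.
Qed.

Lemma Prob_cyl_block N k (w : {ffun 'I_(N * k) -> A}) (i : 'I_N) : p w <= p (block w i).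
Proof.
rewrite -(Prob_cyl X_stationary (i * k)%N%:Z (block w i)).
apply: le_Prob; [exact: measurable_cyl|exact: measurable_cyl|].
by move=> om /readE wE; apply/readE; rewrite -block_read wE.
Qed.

(* Compare the law of [N * k] letters with the product [Q] of the laws of its [k]-blocks: up to
   probability [e ^ -x] it is at least [e ^ -x * Q], and [- ln Q] obeys a law of large numbers. *)
Lemma word_entropy_upper_tail (k : nat) (h delta D : R) : (0 < k)%N -> 0 < delta ->
  (forall n, \sum_(s < n) dm s <= D) ->
  word_entropy k <= k%:R * (h + delta / 4) ->
  exists C : R, 0 <= C /\ forall N, (0 < N)%N ->
    \sum_(w : {ffun 'I_(N * k) -> A} | (N * k)%N%:R * (h + delta) < - ln (p w)) p w
      <= C / N%:R.
Proof.
move=> k0 delta0 dD Hk.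
pose f (v : {ffun 'I_k -> A}) := - ln (p v) - word_entropy k.
pose B := \sum_v `|f v|.
have f_le v : `|f v| <= B by rewrite /B (bigD1 v)//= lerDl sumr_ge0.
have f_mean0 : \sum_v p v * f v = 0.
  under eq_bigr do rewrite mulrBr; rewrite sumrB -mulr_suml sum_Prob_cyl//.
  by rewrite mul1r /word_entropy subrr.
have kR : (0 : R) < k%:R by rewrite ltr0n.
pose V : R := #|{ffun 'I_k -> A}|%:R.
have D0 : 0 <= D by have := dD 0%N; rewrite big_ord0.
(* The first summand comes from e^(-x) <= 1/x with x = N k delta / 2, the second from Chebyshev at
   level k delta / 4. *)
exists (2 / (k%:R * delta) + B ^+ 2 * (2 + 2 * V * D) / (k%:R * (delta / 4)) ^+ 2); split.
  apply: addr_ge0; first by rewrite divr_ge0// mulr_ge0// ltW.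
  by rewrite divr_ge0 ?sqr_ge0// mulr_ge0 ?sqr_ge0// addr_ge0// !mulr_ge0.
move=> N N0; have NR : (0 : R) < N%:R by rewrite ltr0n.
pose delta' := k%:R * (delta / 4).
have delta'0 : 0 < delta' by rewrite mulr_gt0// divr_gt0.
have tail := block_sum_tail X_process X_stationary k0 f_le f_mean0 dD delta'0 N0.
pose x := (N * k)%N%:R * (delta / 2).
have x0 : 0 < x by rewrite /x natrM !mulr_gt0// divr_gt0.
rewrite mulrDl; apply: (@le_trans _ _ (expR (- x) +
    \sum_(w : {ffun 'I_(N * k) -> A} | N%:R * delta' < \sum_(i < N) f (block w i)) p w)); last first.
  apply: lerD; last first.
    apply: (le_trans tail); rewrite le_eqVlt; apply/orP; left; apply/eqP.
    by rewrite -/V -/delta'; field; rewrite !gt_eqF.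
  have -> : 2 / (k%:R * delta) / N%:R = x^-1.
    by rewrite /x natrM; field; rewrite !gt_eqF.
  rewrite expRN lef_pV2 ?posrE ?expR_gt0//.
  by apply: le_trans (expR_ge1Dx x); rewrite lerDr.
(* Word by word: if the block sum is not in its tail, - ln Q(w) <= N k (h + delta) - x, so [p w] is
   at most e^(-x) Q(w). Of the slack delta, a quarter goes to the entropy of a block, a quarter to
   the fluctuation and half to x. *)
apply: (@le_trans _ _ (\sum_(w : {ffun 'I_(N * k) -> A}) (expR (- x) * \prod_(i < N) p (block w i) +
   (if N%:R * delta' < \sum_(i < N) f (block w i) then p w else 0)))); last first.
  rewrite big_split/= -big_mkcond/= lerD2r -mulr_sumr -[leRHS]mulr1 ler_wpM2l ?expR_ge0//.
  by apply: (@sum_prod_block_le1 _ N k R (fun v => p v)) => [v|]; [exact: Prob_ge0|exact: sum_Prob_cyl].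
rewrite big_mkcond/=; apply: ler_sum => w _.
have pr0 : 0 <= expR (- x) * \prod_(i < N) p (block w i).
  by rewrite mulr_ge0 ?expR_ge0// prodr_ge0// => i _; exact: Prob_ge0.
case: ifPn => [up|_]; last by rewrite addr_ge0//; case: ifP => // _; exact: Prob_ge0.
case: ifPn => [_|]; first by rewrite lerDr.
rewrite -leNgt addr0 => notail.
have := Prob_ge0 P (cyl X 0 w); rewrite le_eqVlt => /predU1P[<-//|pw].
have pb i : 0 < p (block w i) by exact: lt_le_trans (Prob_cyl_block w i).
have -> : \prod_(i < N) p (block w i) = expR (- \sum_(i < N) - ln (p (block w i))).
  rewrite -sumrN expR_sum; apply: eq_bigr => i _.
  by rewrite opprK lnK// posrE.
rewrite -expRD -[leLHS]lnK ?posrE// ler_expR.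
have {notail} : \sum_(i < N) - ln (p (block w i)) <= N%:R * (delta' + word_entropy k).
  move: notail; rewrite /f sumrB sumr_const card_ord -mulr_natl; lra.
have : N%:R * (delta' + word_entropy k) <= N%:R * (delta' + k%:R * (h + delta / 4)).
  by rewrite ler_pM2l// lerD2l.
move: up; rewrite /x /delta' natrM.
have : N%:R * (k%:R * (delta / 4) + k%:R * (h + delta / 4)) =
  N%:R * k%:R * (h + delta) - N%:R * k%:R * (delta / 2) :> R by field.
by lra.
Qed.

(** With Plow and Pup the masses of the words below h - eps and above h + delta, the mean of - ln p
    / L gives eps Plow <= 2 delta + C' Pup, where Pup tends to 0. The rates are known along odd
    lengths only, hence the odd factors [N] and [k]. *)
Lemma word_lower_tail (h C D eps tau : R) :
  (forall n, \sum_(s < n) dm s <= D) ->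
  (fun t => word_entropy t.*2.+1 / (t.*2.+1)%:R) @ \oo --> h ->
  (forall t (w : {ffun 'I_t.*2.+1 -> A}), 0 < p w -> - ln (p w) <= C * (t.*2.+1)%:R) ->
  0 < eps -> 0 < tau ->
  exists k N0, odd k /\ forall N, (N0 <= N)%N -> odd N ->
    \sum_(w : {ffun 'I_(N * k) -> A} | expR (- ((N * k)%N%:R * (h - eps))) < p w) p w
      <= tau.
Proof.
move=> dD hlim pC eps0 tau0.
have h0 : 0 <= h.
  rewrite -(cvg_lim (@Rhausdorff R) hlim); apply: limr_ge; first by apply/cvg_ex; exists h.
  by apply: nearW => t; rewrite divr_ge0// word_entropy_ge0.
(* This makes [2 * delta] a quarter of [eps * tau]; the term in Pup will take at most one half. *)
pose delta := eps * tau / 8.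
have delta0 : 0 < delta by rewrite /delta !mulr_gt0.
have : 0 < delta / 4 by rewrite divr_gt0.
move/cvgrPdist_le: hlim => hl /hl[T0 _ HT].
pose k := T0.*2.+1.
have hk : word_entropy k <= k%:R * (h + delta / 4).
  have := HT T0 (leqnn _); rewrite ler_norml => /andP[hh _].
  by rewrite mulrC -ler_pdivrMr ?ltr0n//; move: hh; rewrite -/k; lra.
have [C1 [C10 up]] := word_entropy_upper_tail (isT : 0 < k)%N delta0 dD hk.
pose C' := `|C|.
(* This bound on N yields C' C1 / N <= eps tau / 2. *)
exists k, (Num.bound (2 * C' * C1 / (eps * tau))).+1; split; first by rewrite /k /= odd_double.
move=> N NN0 oN.
have N0 : (0 < N)%N by exact: leq_ltn_trans NN0.
have NR : (0 : R) < N%:R by rewrite ltr0n.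
have {up} := up N N0; set Pup := \sum_(w | _) _ => up.
have odNk : (N * k = (N * k)./2.*2.+1)%N.
  by rewrite -[LHS]odd_double_half oddM oN /= odd_double.
have LR : (0 : R) < (N * k)%N%:R by rewrite ltr0n muln_gt0 N0.
have entL : (N * k)%N%:R * (h - delta) <= word_entropy (N * k).
  have T0Nk : (T0 <= (N * k)./2)%N.
    by rewrite -[X in (X <= _)%N](half_bit_double T0 true) half_leq// leq_pmull.
  have := HT _ T0Nk; rewrite -odNk ler_norml => /andP[_ hh].
  by rewrite mulrC -ler_pdivlMr//; have := delta0; lra.
have pC' (w : {ffun 'I_(N * k) -> A}) : 0 < p w -> - ln (p w) <= C' * (N * k)%N%:R.
  (* The type of the word depends on its length, so the length is generalised before the odd form is
     substituted. *)
  have aux t L (v : {ffun 'I_L -> A}) : L = t.*2.+1 -> 0 < p v -> - ln (p v) <= C' * L%:R.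
    move=> E; move: v; rewrite E => v pv.
    by apply: le_trans (pC _ _ pv) _; rewrite ler_wpM2r// ler_norm.
  exact: aux odNk.
set Plow := \sum_(w | _) _.
have key : word_entropy (N * k) <= (N * k)%N%:R * (h + delta) - (N * k)%N%:R * eps * Plow
    + C' * (N * k)%N%:R * Pup.
  rewrite [X in X - _ + _](_ : _ = (N * k)%N%:R * (h + delta) *
      \sum_(w : {ffun 'I_(N * k) -> A}) p w); last by rewrite sum_Prob_cyl// mulr1.
  rewrite /Plow /Pup.
  rewrite (big_mkcond (fun w => expR _ < _)) (big_mkcond (fun w => _ < - ln _)) /=.
  rewrite !mulr_sumr -sumrB -big_split/=; apply: ler_sum => w _.
  have := Prob_ge0 P (cyl X 0 w); rewrite le_eqVlt => /predU1P[<-|pw].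
    by rewrite mul0r !if_same !mulr0 subr0 addr0.
  have low : (expR (- ((N * k)%N%:R * (h - eps))) < p w) = (- ln (p w) < (N * k)%N%:R * (h - eps)).
    by rewrite -[X in _ < X]lnK ?posrE// ltr_expR ltrNl.
  rewrite low.
  have h1 := pC' w pw.
  have h2 : 0 <= (N * k)%N%:R * (h + delta) by rewrite mulr_ge0// addr_ge0// ltW.
  have h3 : 0 <= C' * (N * k)%N%:R by rewrite mulr_ge0// normr_ge0.
  set z := - ln (p w) in h1 *; set q := p w in pw *.
  rewrite [leRHS](_ : _ =
    q * ((N * k)%N%:R * (h + delta) - (if z < (N * k)%N%:R * (h - eps) then (N * k)%N%:R * eps else 0) +
      (if (N * k)%N%:R * (h + delta) < z then C' * (N * k)%N%:R else 0))); last first.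
    by case: ifP => _; case: ifP => _; ring.
  rewrite ler_pM2l//.
  have h4 : 0 < (N * k)%N%:R * delta by rewrite mulr_gt0.
  have h5 : 0 < (N * k)%N%:R * eps by rewrite mulr_gt0.
  by case: ifPn; case: ifPn; rewrite -?leNgt; lra.
have {key} : (N * k)%N%:R * (eps * Plow) <= (N * k)%N%:R * (2 * delta + C' * Pup) by lra.
rewrite ler_pM2l// => key.
have Pup_le : C' * Pup <= eps * tau / 2.
  apply: (@le_trans _ _ (C' * (C1 / N%:R))); first by rewrite ler_wpM2l// normr_ge0.
  rewrite mulrA ler_pdivrMr//.
  have b0 : 0 <= 2 * C' * C1 / (eps * tau) by rewrite divr_ge0 ?mulr_ge0 ?normr_ge0// ltW.
  have := archi_boundP b0; rewrite ltr_pdivrMr ?mulr_gt0// => hb.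
  have : (Num.bound (2 * C' * C1 / (eps * tau)))%:R * (eps * tau) <= N%:R * (eps * tau).
    by rewrite ler_pM2r ?mulr_gt0// ler_nat ltnW.
  by lra.
by rewrite -(ler_pM2l eps0); rewrite /delta in key; have := mulr_gt0 eps0 tau0; lra.
Qed.

End WordEntropy.

(** * The detector and its error at fixed read positions *)

Section Detector.
Variables (R : realType) (d : measure_display) (Omega : measurableType d)
  (P : probability Omega R) (A : finType) (X : int -> Omega -> A).
Local Notation Pr := (Prob P).
Local Notation p w := (Pr (cyl X 0 w)).
Local Notation dm := (mixing_coef P X).
Hypotheses (X_process : is_process X) (X_stationary : stationary P X).
Hypothesis recurrence_le1 : recurrence P X <= 1.
Variables (l M : nat) (q : R).
Implicit Types (y : {ffun 'I_l -> A}).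

(* [None] beyond the end of the read *)
Definition letter y (j : nat) : option A := omap y (insub j).

(** Typicality is one-sided: only an upper bound on the probability of the word is required. *)
Definition typical_prefix y : bool :=
  [exists w : {ffun 'I_M -> A}, [forall r : 'I_M, letter y r == Some (w r)] && (p w <= q)].

(* Only the first [M] letters of the putative overlap of length [t] are compared. *)
Definition overlap_test y y' (t : nat) : bool :=
  [&& (M <= t)%N, (t <= l)%N,
      [forall r : 'I_M, letter y (l - t + r) == letter y' r] & typical_prefix y'].

(** The index types differ because the overlap [l] occurs only with a positive sign, for equal
    positions. *)
Definition overlap_detector : detector A l := fun y1 y2 =>
  if [pick t : 'I_l.+1 | overlap_test y1 y2 t] is Some t then (t : nat)%:Z
  else if [pick t : 'I_l | overlap_test y2 y1 t] is Some t then - (t : nat)%:Z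
  else 0.

Lemma overlap_detector_Tset y1 y2 : (0 < l)%N -> Tset l (overlap_detector y1 y2).
Proof.
rewrite /Tset /overlap_detector => l0; case: pickP => [t _|_]; first by have := ltn_ord t; lia.
by case: pickP => [t _|_]; [have := ltn_ord t|]; lia.
Qed.

Lemma letter_read i om j : (j < l)%N -> letter (read X l i om) j = Some (X (i + j%:Z) om).
Proof. by move=> jl; rewrite /letter (insubT (fun j => (j < l)%N) jl) /= ffunE. Qed.

Lemma typical_prefix_read i om : (M <= l)%N ->
  typical_prefix (read X l i om) = (p (read X M i om) <= q).
Proof.
move=> Ml; apply/existsP/idP => [[w /andP[/forallP h]]|h].
  rewrite (_ : w = read X M i om)//; apply/ffunP => r.
  by have /eqP := h r; rewrite letter_read ?(leq_trans (ltn_ord r))// ffunE => -[].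
exists (read X M i om); rewrite h andbT; apply/forallP => r.
by rewrite letter_read ?(leq_trans (ltn_ord r))// ffunE.
Qed.

Lemma overlap_test_repetition i i' om t :
  overlap_test (read X l i om) (read X l i' om) t ->
  forall r : 'I_M, X (i + (l - t)%N%:Z + (r : nat)%:Z) om = X (i' + (r : nat)%:Z) om.
Proof.
move=> /and4P[Mt tl /forallP h _] r; have rM := ltn_ord r.
have /eqP := h r; rewrite !letter_read; [|by lia|by lia].
by rewrite PoszD addrA => -[].
Qed.

Lemma overlap_test_shift i i' om t : (M <= t)%N -> (t <= l)%N -> i' = i + (l - t)%N%:Z ->
  overlap_test (read X l i om) (read X l i' om) t = (p (read X M i' om) <= q).
Proof.
move=> Mt tl ii'; rewrite /overlap_test Mt tl /= typical_prefix_read ?(leq_trans Mt)//.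
apply/andb_idl => _; apply/forallP => r; have rM := ltn_ord r.
rewrite !letter_read; [|by lia|by lia].
by rewrite ii' PoszD addrA.
Qed.

Lemma measurable_repetition (a b : int) :
  measurable [set om | forall r : 'I_M, X (a + (r : nat)%:Z) om = X (b + (r : nat)%:Z) om].
Proof.
apply: (sigmaX_measurable X_process (J := setT)); apply: sigmaX_forall => r.
exact: sigmaX_coord_eq.
Qed.

(** A union bound over the candidate overlaps. The inequality of positions excludes the true shift,
    at which agreement is automatic. *)
Lemma Prob_shifted_repetition (g K : nat) (i i' : int) : (0 < g)%N -> (2 * g * K <= M)%N ->
  Pr [set om | exists t : 'I_l.+1, ([set om | i + (l - t)%N%:Z != i'] `&`
     [set om | forall r : 'I_M, X (i + (l - t)%N%:Z + (r : nat)%:Z) om = X (i' + (r : nat)%:Z) om]) om]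
  <= l.+1%:R * ((1 + recurrence P X) / 2 + dm g) ^+ K.
Proof.
move=> g0 KM.
have mconst (Q : Prop) : measurable [set om : Omega | Q].
  by apply: (sigmaX_measurable X_process (J := setT)); exact: sigmaX_const.
have mS (t : 'I_l.+1) : measurable ([set om | i + (l - t)%N%:Z != i'] `&`
     [set om | forall r : 'I_M, X (i + (l - t)%N%:Z + (r : nat)%:Z) om = X (i' + (r : nat)%:Z) om]).
  by apply: measurableI; [exact: mconst|exact: measurable_repetition].
apply: (le_trans (Prob_exists_le _ mS)).
rewrite -[in l.+1%:R](card_ord l.+1) mulr_natl -sumr_const; apply: ler_sum => t _.
have [ii'|/eqP ii'] := pselect (i + (l - t)%N%:Z = i'); last first.
  apply: le_trans (Prob_repetition X_process X_stationary recurrence_le1 KM ii' g0).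
  by apply: le_Prob; [exact: mS|exact: measurable_repetition|move=> om []].
rewrite (_ : _ `&` _ = set0); last first.
  by apply/seteqP; split=> om // [/=]; rewrite ii' eqxx.
rewrite Prob_set0 exprn_ge0// addr_ge0 ?mixing_coef_ge0// divr_ge0//.
have := Prob_coord_eq_le X_process X_stationary 0 (isT : 0 < 1)%N.
by have := Prob_ge0 P [set om | X 0 om = X (0 + 1%:Z) om]; lra.
Qed.

(** Without a repetition at a wrong shift, every test that passes gives the true overlap; with a
    typical prefix on the later read, the true test does pass. The factor 2 counts the two orders of
    the reads. *)
Lemma Prob_detect_overlap_error (g K : nat) (i1 i2 : int) :
  (0 < g)%N -> (2 * g * K <= M)%N ->
  (absz (i2 - i1) < l)%N -> (M <= l - absz (i2 - i1))%N ->
  Pr [set om | overlap_detector (read X l i1 om) (read X l i2 om) != overlap l i1 i2]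
  <= \sum_(w : {ffun 'I_M -> A} | q < p w) p w +
     2 * (l.+1%:R * ((1 + recurrence P X) / 2 + dm g) ^+ K).
Proof.
move=> g0 KM il Ml.
pose c := Num.max i1 i2.
pose NT := [set om | q < p (read X M c om)].
have mNT : measurable NT by exact: (measurable_read X_process c (fun w : {ffun 'I_M -> A} => q < p w)).
have PNT : Pr NT = \sum_(w : {ffun 'I_M -> A} | q < p w) p w.
  rewrite /NT (Prob_read P X_process c (fun w : {ffun 'I_M -> A} => q < p w)).
  by apply: eq_bigr => w _; rewrite Prob_cyl.
rewrite -PNT.
pose S (i i' : int) := [set om | exists t : 'I_l.+1, ([set om | i + (l - t)%N%:Z != i'] `&`
     [set om | forall r : 'I_M, X (i + (l - t)%N%:Z + (r : nat)%:Z) om = X (i' + (r : nat)%:Z) om]) om].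
have mS i i' : measurable (S i i').
  apply: measurable_exists => t; apply: measurableI; last exact: measurable_repetition.
  by apply: (sigmaX_measurable X_process (J := setT)); exact: sigmaX_const.
apply: (@le_trans _ _ (Pr (NT `|` (S i1 i2 `|` S i2 i1)))); last first.
  apply: (le_trans (Prob_setU_le P mNT (measurableU _ _ (mS _ _) (mS _ _)))).
  rewrite lerD2l (le_trans (Prob_setU_le P (mS _ _) (mS _ _)))// mulrDl !mul1r.
  by apply: lerD; exact: Prob_shifted_repetition.
apply: le_Prob.
- exact: (measurable_read2 X_process i1 i2 (fun y1 y2 => overlap_detector y1 y2 != overlap l i1 i2)).
- by apply: measurableU => //; exact: measurableU.
move=> om /= err; apply: contrapT => nbad.
have nNT : p (read X M c om) <= q by rewrite leNgt; apply/negP => h; apply: nbad; left.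
have shift i i' t : S i i' = S i1 i2 \/ S i i' = S i2 i1 -> (t <= l)%N ->
    overlap_test (read X l i om) (read X l i' om) t -> i + (l - t)%N%:Z = i'.
  move=> ii' tl /overlap_test_repetition h; apply/eqP/negPn/negP => ne.
  have : S i i' om by exists (inord t); rewrite /= inordK.
  by move=> Sii'; apply: nbad; case: ii' => <-; right; [left|right].
have t1 t : (t <= l)%N -> overlap_test (read X l i1 om) (read X l i2 om) t -> i1 + (l - t)%N%:Z = i2.
  by apply: shift; left.
have t2 t : (t <= l)%N -> overlap_test (read X l i2 om) (read X l i1 om) t -> i2 + (l - t)%N%:Z = i1.
  by apply: shift; right.
move/negP: err; apply; apply/eqP; rewrite /overlap_detector /overlap.
pose t0 := (l - absz (i2 - i1))%N.
have t0l : (t0 <= l)%N by rewrite leq_subr.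
case: pickP => [t /t1|no1].
  by have tl := ltn_ord t => /(_ tl) h; case: ifP; lia.
case: pickP => [t /t2|no2].
  by have tl := ltn_ord t => /(_ (ltnW tl)) h; case: ifP; lia.
(* Silence is impossible: the true overlap has at least [M] letters and starts with a typical
   word. *)
have [i12|i21] := leP i1 i2.
  have := no1 (inord t0); rewrite inordK//= overlap_test_shift//; last by rewrite /t0; lia.
  by move: nNT; rewrite /c (max_idPr i12) => ->.
have t0l' : (t0 < l)%N by rewrite /t0; lia.
have := no2 (Ordinal t0l'); rewrite /= overlap_test_shift//; last by rewrite /t0; lia.
by move: nNT; rewrite /c (max_idPl (ltW i21)) => ->.
Qed.

(** Such an event lies in a single cylinder, of probability at most [q] by stationarity. *)
Lemma Prob_constant_word (c : int) (S : set Omega) : 0 <= q -> measurable S ->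
  (forall om, S om -> p (read X M c om) <= q) ->
  (forall om om', S om -> S om' -> read X M c om = read X M c om') -> Pr S <= q.
Proof.
move=> q0 mS Sq Sc; have [[om0 S0]|nS] := pselect (exists om, S om); last first.
  by rewrite (_ : S = set0) ?Prob_set0//; apply/seteqP; split=> om // ?; case: nS; exists om.
apply: le_trans (Sq _ S0); rewrite -(Prob_cyl X_stationary c).
apply: le_Prob => // [|om Som]; first exact: measurable_cyl.
by apply/readE; exact: Sc.
Qed.

(** Fix the value x of the earlier read. An alarm at overlap t then forces one definite typical word
    on the later read, which costs at most [q]; mixing pays for treating the reads as
    independent. *)
Lemma Prob_false_alarm (a b : int) : 0 <= q -> a + l%:Z <= b ->
  Pr [set om | exists t : 'I_l.+1, overlap_test (read X l a om) (read X l b om) t \/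
                                   overlap_test (read X l b om) (read X l a om) t]
  <= 2 * (l.+1%:R * q) + dm (absz (b - a) - l + 1).
Proof.
move=> q0 ab; set S := [set om | _].
pose F x := [set om | exists t : 'I_l.+1, overlap_test x (read X l b om) t \/
                                   overlap_test (read X l b om) x t].
have mS : measurable S.
  exact: (measurable_read2 X_process a b (fun y y' => exists t : 'I_l.+1, overlap_test y y' t \/
    overlap_test y' y t)).
have mF x : measurable (F x).
  exact: (measurable_read X_process b (fun y' => exists t : 'I_l.+1, overlap_test x y' t \/
    overlap_test y' x t)).
have FE x : Pr (F x) <= 2 * (l.+1%:R * q).
  pose F1 (t : 'I_l.+1) := [set om | overlap_test x (read X l b om) t].
  pose F2 (t : 'I_l.+1) := [set om | overlap_test (read X l b om) x t].
  have m1 t : measurable (F1 t) by exact: (measurable_read X_process b (fun y => overlap_test x y t)).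
  have m2 t : measurable (F2 t) by exact: (measurable_read X_process b (fun y => overlap_test y x t)).
  have mF12 t : measurable (F1 t `|` F2 t) by exact: measurableU.
  apply: (le_trans (Prob_exists_le P mF12)).
  rewrite -[in l.+1%:R](card_ord l.+1) !mulr_natl -sumr_const -sumrMnl.
  apply: ler_sum => t _; rewrite mulr2n.
  apply: (le_trans (Prob_setU_le P (m1 t) (m2 t))); apply: lerD.
    (* The later read must begin with the letters of x found from offset [l - t] on. *)
    apply: (Prob_constant_word (c := b)) => // [om|om om'].
      by move=> /and4P[Mt tl _]; rewrite typical_prefix_read// (leq_trans Mt).
    move=> /and4P[Mt tl /forallP h _] /and4P[_ _ /forallP h' _]; apply/ffunP => r.
    have := ltn_ord r => rM; have := h r; rewrite (eqP (h' r)) !ffunE !letter_read; [|by lia|by lia].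
    by move=> /eqP[->].
  (* The later read must contain the typical prefix of x at offset [l - t]. *)
  apply: (Prob_constant_word (c := b + (l - t)%N%:Z)) => // [om|om om'].
    move=> /and4P[Mt tl /forallP h /existsP[w /andP[/forallP hw]]].
    rewrite (_ : read X M _ om = w)//; apply/ffunP => r; rewrite ffunE.
    have := ltn_ord r => rM; have := h r; rewrite (eqP (hw r)) letter_read; last by lia.
    by rewrite PoszD addrA => /eqP[->].
  move=> /and4P[Mt tl /forallP h _] /and4P[_ _ /forallP h' _]; apply/ffunP => r.
  have := ltn_ord r => rM; have := h r; rewrite -(eqP (h' r)) !ffunE !letter_read; [|by lia|by lia].
  by rewrite !PoszD !addrA => /eqP[->].
have mread x : measurable (read X l a @^-1` [set x]) by rewrite preimage_read; exact: measurable_cyl.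
rewrite (Prob_partition _ mS mread).
apply: (@le_trans _ _ (\sum_x p x * (2 * (l.+1%:R * q) + dm (absz (b - a) - l + 1)))); last first.
  by rewrite -mulr_suml sum_Prob_cyl// mul1r.
apply: ler_sum => x _; rewrite preimage_read.
have sE : sigmaX X [set j | j <= a + l%:Z - 1] (cyl X a x).
  by apply: sigmaX_cyl => k kl /=; lia.
have sF : sigmaX X [set j | a + l%:Z - 1 + (absz (b - a) - l + 1)%N%:Z <= j] (F x).
  apply: (@sigmaX_read _ _ _ X _ b l (fun y' => exists t : 'I_l.+1, overlap_test x y' t \/
    overlap_test y' x t)) => k kl /=; lia.
have := Prob_setI_mixing P X_process sE sF; rewrite (Prob_cyl X_stationary) => h.
apply: (@le_trans _ _ (Pr (cyl X a x `&` F x))).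
  apply: le_Prob; [|by apply: measurableI => //; exact: measurable_cyl|].
    by apply: measurableI => //; exact: measurable_cyl.
  by move=> om [[t St] cx]; split=> //; move/readE: cx St => -> St; exists t.
by apply: (le_trans h); rewrite ler_wpM2l ?Prob_ge0// lerD2r.
Qed.

(** Here the true overlap is 0, the default answer, so an error needs an alarm. *)
Lemma Prob_detect_nonoverlap_error (i1 i2 : int) : 0 <= q -> (0 < l)%N ->
  (l <= absz (i2 - i1))%N ->
  Pr [set om | overlap_detector (read X l i1 om) (read X l i2 om) != overlap l i1 i2]
  <= 2 * (l.+1%:R * q) + dm (absz (i2 - i1) - l + 1).
Proof.
move=> q0 l0 li.
pose S a b := [set om | exists t : 'I_l.+1, overlap_test (read X l a om) (read X l b om) t \/
                                   overlap_test (read X l b om) (read X l a om) t].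
have mS a b : measurable (S a b).
  exact: (measurable_read2 X_process a b (fun y y' => exists t : 'I_l.+1, overlap_test y y' t \/
    overlap_test y' y t)).
have SC a b : S a b = S b a.
  by apply/seteqP; split => om [t [h|h]]; exists t; [right|left|right|left].
have sub : [set om | overlap_detector (read X l i1 om) (read X l i2 om) != overlap l i1 i2]
    `<=` S i1 i2.
  move=> om /= err; apply: contrapT => nS; move/negP: err; apply; apply/eqP.
  rewrite /overlap_detector; case: pickP => [t h|_]; first by case: nS; exists t; left.
  case: pickP => [t h|_].
    by case: nS; exists (widen_ord (leqnSn l) t); right.
  by rewrite /overlap; case: ifP; lia.
apply: (le_trans (le_Prob P _ (mS _ _) sub)).
  exact: (measurable_read2 X_process i1 i2 (fun y1 y2 => overlap_detector y1 y2 != overlap l i1 i2)).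
have [h|h] := leP i1 i2; first by apply: Prob_false_alarm => //; lia.
rewrite SC (_ : absz (i2 - i1) = absz (i1 - i2)); last by lia.
by apply: Prob_false_alarm => //; lia.
Qed.

End Detector.

(** * Averaging the error over the read positions *)

Section ErrorSum.
Variables (R : realType) (d : measure_display) (Omega : measurableType d)
  (P : probability Omega R) (A : finType) (X : int -> Omega -> A).
Local Notation Pr := (Prob P).
Local Notation dm := (mixing_coef P X).

Lemma mem_zrange a b z : (z \in zrange a b) = (a <= z <= b).
Proof.
rewrite /zrange; case: ltP => ab; first by rewrite in_nil; lia.
apply/mapP/idP => [[k]|h]; first by rewrite mem_iota => h ->; lia.
by exists (absz (z - a)); rewrite ?mem_iota; lia.
Qed.

Lemma zrange_uniq a b : uniq (zrange a b).
Proof.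
rewrite /zrange; case: ifP => // _; rewrite map_inj_uniq ?iota_uniq//.
by move=> x y; lia.
Qed.

Lemma size_zrange a (n : nat) : size (zrange a (a + n%:Z - 1)) = n.
Proof.
rewrite /zrange; case: ltP => h; first by case: n h => //= n; lia.
by rewrite size_map size_iota; lia.
Qed.

Lemma supp2_props (n l : nat) (i1 : int) : 1 <= i1 <= n%:Z ->
  [/\ uniq (supp2 n l i1), size (supp2 n l i1) = n &
      forall i2, i2 \in supp2 n l i1 -> (absz (i2 - i1) < l + n)%N].
Proof.
move=> i1n; rewrite /supp2; case: ifP => [h1|h1].
  split; [exact: zrange_uniq| |by move=> i2; rewrite mem_zrange; lia].
  by rewrite -[RHS](size_zrange (i1 - l%:Z + 1)); congr (size (zrange _ _)); lia.
case: ifP => [h2|h2].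
  split; [exact: zrange_uniq| |by move=> i2; rewrite mem_zrange; lia].
  by rewrite -[RHS](size_zrange 1); congr (size (zrange _ _)); lia.
split; [exact: zrange_uniq| |by move=> i2; rewrite mem_zrange; lia].
by rewrite -[RHS](size_zrange (i1 + l%:Z - n%:Z)); congr (size (zrange _ _)); lia.
Qed.

Lemma Perr_ge0 n l (Th : detector A l) : 0 <= Perr P X n Th.
Proof.
apply: sumr_ge0 => i1 _; rewrite mulr_ge0 ?invr_ge0//; apply: sumr_ge0 => i2 _.
by rewrite !mulr_ge0 ?invr_ge0 ?Prob_ge0.
Qed.

(** Every support of I(2) has n elements, so each pair weighs n^-2; for fixed I(1) each distance
    occurs at most twice. *)
Lemma Perr_le n l (Th : detector A l) (G : nat -> R) :
  (forall k, 0 <= G k) ->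
  (forall i1 i2, Pr [set om | Th (read X l i1 om) (read X l i2 om) != overlap l i1 i2]
     <= G (absz (i2 - i1))) ->
  n%:R * Perr P X n Th <= 2 * \sum_(k < l + n) G k.
Proof.
move=> G0 hG; case: n => [|n].
  by rewrite mul0r mulr_ge0// sumr_ge0.
have n0 : (0 : R) < n.+1%:R by rewrite ltr0n.
set S := 2 * _.
apply: (@le_trans _ _ (n.+1%:R * \sum_(i1 <- zrange 1 n.+1%:Z) n.+1%:R^-1 * (n.+1%:R^-1 * S))).
  rewrite ler_pM2l// /Perr big_seq [leRHS]big_seq; apply: ler_sum => i1.
  rewrite mem_zrange => /(@supp2_props n.+1 l)[us ss hs].
  rewrite ler_wpM2l ?invr_ge0// -mulr_sumr ss ler_wpM2l ?invr_ge0//.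
  apply: le_trans (sum_dist_le us G0 hs).
  by apply: ler_sum => i2 _; exact: hG.
rewrite big_const_seq iter_addr addr0 count_predT.
rewrite (_ : size _ = n.+1); last by rewrite -[RHS](size_zrange 1); congr (size (zrange _ _)); lia.
by rewrite -mulr_natl le_eqVlt; apply/orP; left; apply/eqP; field; rewrite gt_eqF.
Qed.

Lemma Pstar_le n l (Th : detector A l) : (forall y1 y2, Tset l (Th y1 y2)) ->
  Pstar P X n l <= Perr P X n Th.
Proof.
move=> hT; apply: ge_inf; last by exists Th.
by exists 0 => _ [Th' _ <-]; exact: Perr_ge0.
Qed.

Hypotheses (X_process : is_process X) (X_stationary : stationary P X).

(** The constant answer 0 errs only when the reads overlap. This gives the beta branch of the
    minimum. *)
Lemma Pstar_trivial n l : (0 < l)%N -> n%:R * Pstar P X n l <= 2 * l%:R.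
Proof.
move=> l0; pose Th : detector A l := fun _ _ => 0.
apply: (@le_trans _ _ (n%:R * Perr P X n Th)).
  by rewrite ler_wpM2l//; apply: Pstar_le => y1 y2; rewrite /Tset /Th; lia.
apply: (le_trans (@Perr_le n l Th (fun k => (k < l)%N%:R) _ _)) => //.
  move=> i1 i2; case: ltnP => h.
    apply: Prob_le1.
    exact: (measurable_read2 X_process i1 i2 (fun y1 y2 => Th y1 y2 != overlap l i1 i2)).
  rewrite (_ : [set om | _] = set0) ?Prob_set0//; apply/seteqP; split => om //= /negP; apply.
  by apply/eqP; rewrite /Th /overlap; case: ifP; lia.
rewrite ler_pM2l// big_split_ord/= [X in _ + X]big1 ?addr0.
  by rewrite (eq_bigr (fun=> 1)) ?sumr_const ?card_ord// => i _; rewrite ltn_ord.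
by move=> i _; rewrite ltnNge leq_addr.
Qed.

Lemma sum_short_overlaps (l M : nat) : (\sum_(k < l) (l - k < M) <= M)%N.
Proof.
(* Strengthened to the minimum: when l + 1 < M the new term adds 1, and a bound by [M] alone would
   not carry the induction. *)
suff : (\sum_(k < l) (l - k < M) <= minn l M)%N by rewrite leq_min => /andP[].
elim: l => [|l IH]; first by rewrite big_ord0.
rewrite big_ord_recl/=; under eq_bigr do rewrite /bump/= add1n subSS.
move: IH; rewrite subn0; move: (\sum_(_ < _) _)%N => S.
case: (ltnP l.+1 M) => h /=; lia.
Qed.

Hypothesis recurrence_le1 : recurrence P X <= 1.

Lemma Pstar_detector (n l M g K : nat) (q tau D : R) :
  (0 < l)%N -> (0 < g)%N -> (2 * g * K <= M)%N -> 0 <= q ->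
  (forall n, \sum_(s < n) dm s <= D) ->
  \sum_(w : {ffun 'I_M -> A} | q < Pr (cyl X 0 w)) Pr (cyl X 0 w) <= tau ->
  n%:R * Pstar P X n l <=
    2 * (M%:R + l%:R * (tau + 2 * (l.+1%:R * ((1 + recurrence P X) / 2 + dm g) ^+ K))
         + n%:R * (2 * (l.+1%:R * q)) + D).
Proof.
move=> l0 g0 KM q0 dD htau.
pose Th := @overlap_detector R d Omega P A X l M q.
set e := tau + _; set q' := 2 * (_ * q).
have e0 : 0 <= e.
  rewrite addr_ge0//; first by apply: le_trans htau; apply: sumr_ge0 => w _; exact: Prob_ge0.
  rewrite mulr_ge0// mulr_ge0// exprn_ge0// addr_ge0 ?mixing_coef_ge0// divr_ge0// addr_ge0//.
  exact: le_trans (Prob_ge0 P _) (Prob_coord_eq_le X_process X_stationary 0 (isT : 0 < 1)%N).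
have q'0 : 0 <= q' by rewrite /q' !mulr_ge0.
have dm0 s : 0 <= dm s by exact: mixing_coef_ge0.
(* Three regimes of the distance k: long overlaps cost [e], overlaps shorter than [M] the trivial
   bound 1, disjoint reads a false alarm at mixing gap k - l + 1. *)
pose G k := if (k < l)%N then (if (M <= l - k)%N then e else 1) else q' + dm (k - l + 1).
apply: (@le_trans _ _ (n%:R * Perr P X n Th)).
  by rewrite ler_wpM2l//; apply: Pstar_le => y1 y2; exact: overlap_detector_Tset.
apply: (le_trans (@Perr_le n l Th G _ _)).
- by move=> k; rewrite /G; case: ifP => _; [case: ifP|rewrite addr_ge0].
- move=> i1 i2; rewrite /G; case: ltnP => il; last exact: Prob_detect_nonoverlap_error.
  case: leqP => Ml.
    apply: (le_trans (Prob_detect_overlap_error X_process X_stationary recurrence_le1 q g0 KM il Ml)).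
    by rewrite /e lerD2r.
  apply: Prob_le1.
  exact: (measurable_read2 X_process i1 i2 (fun y1 y2 => Th y1 y2 != overlap l i1 i2)).
rewrite ler_pM2l// big_split_ord/= -addrA; apply: lerD.
  apply: (@le_trans _ _ (\sum_(k < l) ((l - k < M)%N%:R + e))).
    apply: ler_sum => k _; rewrite /G ltn_ord; case: leqP => _; first by rewrite add0r.
    by rewrite lerDl.
  rewrite big_split/= sumr_const card_ord -[e *+ l]mulr_natl -natr_sum lerD2r ler_nat.
  exact: sum_short_overlaps.
apply: (@le_trans _ _ (\sum_(k < n) (q' + dm k.+1))).
  by apply: ler_sum => k _; rewrite /G ltnNge leq_addr/= addKn addn1.
rewrite big_split/= sumr_const card_ord -[q' *+ n]mulr_natl lerD2l.
by apply: le_trans (dD n.+1); rewrite big_ord_recl/= lerDr.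
Qed.

End ErrorSum.

(** * Choice of the parameters as n grows *)

Lemma affine_le_linear (R : realFieldType) (b x l : R) :
  1 <= x -> l <= b * x + 1 -> l <= (b + 1) * x /\ l + 1 <= (b + 2) * x.
Proof. by lra. Qed.

(** The budget for [eta]: a quarter for the word length and an eighth for each of the four other
    bounds. Here [h] stands for the inverse of the entropy rate. *)
Lemma sum_error_terms_le (R : realFieldType) (M T E Q D k h eta x : R) :
  0 < eta * x -> M <= (h + eta / 8) * x + k -> 2 * T <= eta / 8 * x -> 2 * E <= eta / 8 * x ->
  2 * Q <= eta / 8 * x -> 2 * k + 2 * D <= eta / 8 * x ->
  2 * (M + (T + E) + Q + D) <= (2 * h + eta) * x.
Proof. by lra. Qed.

Section Asymptotics.
Variables (R : realType) (d : measure_display) (Omega : measurableType d)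
  (P : probability Omega R) (A : finType) (X : int -> Omega -> A).
Local Notation Pr := (Prob P).
Local Notation dm := (mixing_coef P X).

(** Since e^(c x) is the square of e^(c x / 2) >= c x / 2, the product is at most 4 / (c^2 x). *)
Lemma linear_times_exp_small (c s : R) : 0 < c -> 0 < s ->
  exists x0, forall x, x0 <= x -> x * expR (- (c * x)) <= s.
Proof.
move=> c0 s0; exists (Num.max 1 (4 / (c ^+ 2 * s))) => x; rewrite ge_max => /andP[x1 xs].
have x0 : 0 < x by lra.
rewrite expRN ler_pdivrMr ?expR_gt0//.
have e1 : c * x / 2 <= expR (c * x / 2).
  by apply: le_trans (expR_ge1Dx _); rewrite lerDr.
have cx0 : 0 <= c * x / 2 by rewrite divr_ge0// mulr_ge0// ltW.
have -> : c * x = c * x / 2 + c * x / 2 by field.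
rewrite expRD; apply: (@le_trans _ _ (s * (c * x / 2 * (c * x / 2)))).
  move: xs; rewrite ler_pdivrMr ?mulr_gt0 ?exprn_gt0// => xs.
  have := ler_wpM2r (ltW x0) xs; lra.
by rewrite ler_pM2l// ler_pM.
Qed.

Hypotheses (X_process : is_process X) (X_stationary : stationary P X).

(* With [h' = (1/h + eta/16)^-1 < h] and [M] close to [(1/h + eta/8) * ln n], a typical word of
   length [M] has probability at most [exp (- h' M) = o(1/n)]. *)
Lemma Pstar_detector_asymptotic (h C D b eta : R) :
  0 < h -> 0 < b -> 0 < eta -> recurrence P X < 1 ->
  dm @ \oo --> 0 ->
  (forall n, \sum_(s < n) dm s <= D) ->
  (fun t => word_entropy P X t.*2.+1 / (t.*2.+1)%:R) @ \oo --> h ->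
  (forall t (w : {ffun 'I_t.*2.+1 -> A}), 0 < Pr (cyl X 0 w) ->
     - ln (Pr (cyl X 0 w)) <= C * (t.*2.+1)%:R) ->
  exists x0 : R, forall (n l : nat), x0 <= ln n%:R -> (0 < l)%N -> l%:R <= b * ln n%:R + 1 ->
    n%:R * Pstar P X n l <= (2 / h + eta) * ln n%:R.
Proof.
move=> h0 b0 eta0 R1 dm0 dD hlim pC.
have recurrence_ge0 : 0 <= recurrence P X.
  exact: le_trans (Prob_ge0 P _) (Prob_coord_eq_le X_process X_stationary 0 (isT : 0 < 1)%N).
have D0 : 0 <= D by have := dD 0%N; rewrite big_ord0.
(* Taking dm g <= (1 - R) / 4 gives rho <= (3 + R) / 4 < 1, where R is the recurrence. *)
have [g [g0 [rho [rho0 rho1 rhoE]]]] : exists g, (0 < g)%N /\ exists rho,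
    [/\ 0 <= rho, rho < 1 & rho = (1 + recurrence P X) / 2 + dm g].
  have e0 : 0 < (1 - recurrence P X) / 4 by rewrite divr_gt0// subr_gt0.
  move/cvgrPdist_le: dm0 => /(_ _ e0)[T _ HT]; exists T.+1; split=> //.
  exists ((1 + recurrence P X) / 2 + dm T.+1); split=> //.
    by rewrite addr_ge0 ?mixing_coef_ge0// divr_ge0// addr_ge0.
  have := HT T.+1 (leqnSn T); rewrite sub0r normrN ger0_norm ?mixing_coef_ge0//; lra.
pose a := 1 - rho.
have a0 : 0 < a by rewrite /a; lra.
have rho_le : rho <= expR (- a) by apply: le_trans (expR_ge1Dx _); rewrite /a; lra.
pose h' := (h^-1 + eta / 16)^-1.
pose c1 := h^-1 + eta / 8.
have hV : 0 < h^-1 by rewrite invr_gt0.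
have den0 : 0 < h^-1 + eta / 16 by rewrite addr_gt0// divr_gt0.
have h'0 : 0 < h' by rewrite invr_gt0.
have c10 : 0 < c1 by rewrite addr_gt0// divr_gt0.
have h'h : h' < h.
  by rewrite -[ltRHS]invrK /h' ltf_pV2 ?posrE// ltrDl divr_gt0.
(* The gain in the exponent: as h' c1 = 1 + kap, n e^(-h' M) is of order n^(-kap). *)
pose kap := h' * (eta / 16).
have kap0 : 0 < kap by rewrite mulr_gt0// divr_gt0.
have h'c1 : h' * c1 = 1 + kap.
  rewrite /kap /c1 (_ : h^-1 + eta / 8 = (h^-1 + eta / 16) + eta / 16); last by field; rewrite gt_eqF.
  by rewrite mulrDr mulVf// gt_eqF.
pose tau := eta / (16 * (b + 1)).
have tau0 : 0 < tau by rewrite divr_gt0// mulr_gt0// addr_gt0.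
have hh' : 0 < h - h' by rewrite subr_gt0.
have [k [N0 [ok low]]] := word_lower_tail X_process X_stationary dD hlim pC hh' tau0.
have k0 : (0 < k)%N by case: (k) ok.
have kR : (0 : R) < k%:R by rewrite ltr0n.
have gR : (0 : R) < g%:R by rewrite ltr0n.
pose c2 := a * c1 / (2 * g%:R).
have c20 : 0 < c2 by rewrite divr_gt0// mulr_gt0.
(* [C2] absorbs the rounding of [M] and of [K], [C3] that of [M]; [s2] and [s3] then make their
   error terms at most [eta / 8 * x]. *)
pose C2 := expR (a + a * k%:R / (2 * g%:R)).
pose C3 := expR (h' * k%:R).
have C20 : 0 < C2 by exact: expR_gt0.
have C30 : 0 < C3 by exact: expR_gt0.
pose s2 := eta / (32 * (b + 2) ^+ 2 * C2).
pose s3 := eta / (32 * (b + 2) * C3).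
have b20 : 0 < b + 2 by rewrite addr_gt0.
have s20 : 0 < s2 by rewrite divr_gt0// !mulr_gt0// exprn_gt0.
have s30 : 0 < s3 by rewrite divr_gt0// !mulr_gt0.
have [x2 hx2] := linear_times_exp_small c20 s20.
have [x3 hx3] := linear_times_exp_small kap0 s30.
(* The entries ensure, in order: ln n >= 1, smallness of the two exponential terms, [N0 <= N], and
   absorption of the constants [2 * k + 2 * D]. *)
exists (Num.max (Num.max (Num.max 1 x2) x3)
  (Num.max (2 * k%:R * N0.+1%:R / c1) ((2 * k%:R + 2 * D) * 8 / eta))) => n l.
rewrite !ge_max => /andP[/andP[/andP[x1 /hx2 hx2n] /hx3 hx3n] /andP[xN xD]] l0 lb.
set x := ln n%:R in x1 hx2n hx3n xN xD lb *.
have x0 : 0 < x by exact: lt_le_trans x1.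
have n0 : (0 : R) < n%:R.
  by rewrite ltNge; apply/negP => /ln0 h1; move: x0; rewrite /x h1 ltxx.
have nE : n%:R = expR x by rewrite lnK.
pose u := c1 * x / (2 * k%:R).
have u0 : 0 <= u by rewrite divr_ge0// mulr_ge0// ltW.
(* An odd number within 1 of c1 x / k, so that M = N k is within k of c1 x. *)
pose N := (Num.truncn u).*2.+1.
have /andP[Nu1 Nu2] := truncn_itv u0.
have NR : N%:R = 2 * (Num.truncn u)%:R + 1 :> R by rewrite /N -addn1 natrD -mul2n natrM.
have uE : u * (2 * k%:R) = c1 * x by rewrite /u; field; rewrite gt_eqF.
have N0N : (N0 <= N)%N.
  apply: (@leq_trans (Num.truncn u)); last by rewrite /N ltnW// ltnS -addnn leq_addr.
  rewrite truncn_ge_nat//; apply: (@le_trans _ _ N0.+1%:R); first by rewrite ler_nat.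
  by rewrite /u ler_pdivlMr ?mulr_gt0//; move: xN; rewrite ler_pdivrMr// [x * _]mulrC [leLHS]mulrC.
have oN : odd N by rewrite /N /= odd_double.
have {low} := low N N0N oN.
set M := (N * k)%N; rewrite (_ : h - (h - h') = h'); last by ring.
set q := expR _ => htau.
have ME : M%:R = N%:R * k%:R :> R by rewrite /M natrM.
have M1 : M%:R <= c1 * x + k%:R.
  rewrite ME NR -uE; have := ler_wpM2r (ltW kR) Nu1; clear; lra.
have M2 : c1 * x - k%:R <= M%:R.
  rewrite ME NR -uE; have := ler_wpM2r (ltW kR) (ltW Nu2).
  by rewrite -natr1; clear; lra.
pose K := (M %/ (2 * g))%N.
have KM : (2 * g * K <= M)%N by rewrite /K mulnC leq_divM.
have q0 : 0 <= q by exact: expR_ge0.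
have bnd := Pstar_detector X_process X_stationary (ltW R1) n l0 g0 KM q0 dD htau.
apply: (le_trans bnd).
rewrite -rhoE.
have rhoK : rho ^+ K <= C2 * expR (- (c2 * x)).
  apply: (@le_trans _ _ (expR (- a) ^+ K)); first by rewrite lerXn2r ?nnegrE ?expR_ge0.
  rewrite -expRM_natl -expRD ler_expR.
  have MK : M%:R <= (2 * g%:R) * (K%:R + 1) :> R.
    have : (M <= 2 * g * K.+1)%N by rewrite mulnC ltnW// ltn_ceil// muln_gt0.
    by rewrite -(ler_nat R) (natrM _ (2 * g)) (natrM _ 2) -(natr1 K).
  have g20 : 0 < 2 * g%:R :> R by rewrite mulr_gt0.
  have : (c1 * x - k%:R) / (2 * g%:R) <= K%:R + 1.
    by rewrite ler_pdivrMr// [leRHS]mulrC; exact: le_trans M2 MK.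
  move/(ler_wpM2l (ltW a0)).
  have -> : a * ((c1 * x - k%:R) / (2 * g%:R)) = c2 * x - a * k%:R / (2 * g%:R).
    by rewrite /c2; field; rewrite gt_eqF.
  clear; lra.
have nq : n%:R * q <= C3 * expR (- (kap * x)).
  rewrite nE /q -!expRD ler_expR.
  have := ler_wpM2l (ltW h'0) M2; rewrite mulrBr mulrA h'c1; clear; lra.
have [lx1 l1x'] := affine_le_linear x1 lb.
have l1x : l.+1%:R <= (b + 2) * x by rewrite -natr1.
have lx : l%:R <= (b + 2) * x by apply: le_trans l1x; rewrite ler_nat.
have b1 : 2 * (l%:R * tau) <= eta / 8 * x.
  apply: (@le_trans _ _ (2 * ((b + 1) * x * tau))).
    by rewrite ler_pM2l// ler_wpM2r// ltW.
  rewrite le_eqVlt; apply/orP; left; apply/eqP; rewrite /tau; field.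
  by rewrite gt_eqF// addr_gt0.
have b2 : 2 * (l%:R * (2 * (l.+1%:R * rho ^+ K))) <= eta / 8 * x.
  apply: (@le_trans _ _ (2 * ((b + 2) * x * (2 * ((b + 2) * x * (C2 * expR (- (c2 * x)))))))).
    rewrite ler_pM2l//; apply: ler_pM => //.
      by rewrite !mulr_ge0// exprn_ge0.
    by rewrite ler_pM2l//; apply: ler_pM => //; rewrite exprn_ge0.
  have -> : 2 * ((b + 2) * x * (2 * ((b + 2) * x * (C2 * expR (- (c2 * x)))))) =
    4 * (b + 2) ^+ 2 * C2 * x * (x * expR (- (c2 * x))) by ring.
  apply: (@le_trans _ _ (4 * (b + 2) ^+ 2 * C2 * x * s2)).
    by rewrite ler_wpM2l// !mulr_ge0// ?exprn_ge0// ltW.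
  rewrite le_eqVlt; apply/orP; left; apply/eqP; rewrite /s2; field.
  by rewrite !gt_eqF.
have b3 : 2 * (n%:R * (2 * (l.+1%:R * q))) <= eta / 8 * x.
  have -> : 2 * (n%:R * (2 * (l.+1%:R * q))) = 4 * (l.+1%:R * (n%:R * q)) by ring.
  apply: (@le_trans _ _ (4 * ((b + 2) * x * (C3 * expR (- (kap * x)))))).
    rewrite ler_pM2l//; apply: ler_pM => //.
    by rewrite mulr_ge0 ?expR_ge0.
  have es3 : expR (- (kap * x)) <= s3.
    by apply: le_trans hx3n; rewrite ler_peMl ?expR_ge0.
  apply: (@le_trans _ _ (4 * ((b + 2) * x * (C3 * s3)))).
    rewrite ler_pM2l// ler_pM2l; last by rewrite mulr_gt0.
    by rewrite ler_pM2l.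
  rewrite le_eqVlt; apply/orP; left; apply/eqP; rewrite /s3; field.
  by rewrite !gt_eqF.
have b4 : 2 * k%:R + 2 * D <= eta / 8 * x.
  by rewrite mulrAC ler_pdivlMr// [leRHS]mulrC -ler_pdivrMr.
by rewrite (mulrDr l%:R); apply: sum_error_terms_le b4; rewrite ?mulr_gt0.
Qed.

End Asymptotics.

(** The sequence is the relative excess itself, cut off at 0; the bounds for all e > 0 say exactly
    that it vanishes. *)
Lemma vanishing_excess (R : realType) (u c : nat -> R) (Q : pred nat) (m : R) : 0 < m ->
  (forall n, Q n -> 0 < c n) ->
  (forall e, 0 < e -> \forall n \near \oo, Q n -> u n <= 2 * (1 + e) * m * c n) ->
  exists eps : nat -> R, eps @ \oo --> 0 /\
    forall n, Q n -> u n <= 2 * (1 + eps n) * m * c n.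
Proof.
move=> m0 c0 hu.
pose eps n := if Q n then Num.max 0 (u n / (2 * m * c n) - 1) else 0.
exists eps; split; last first.
  move=> n Qn; have mc : 0 < 2 * m * c n by rewrite !mulr_gt0// c0.
  rewrite (_ : 2 * _ * m * c n = (1 + eps n) * (2 * m * c n)); last by ring.
  by rewrite -ler_pdivrMr// -lerBlDl /eps Qn le_max lexx orbT.
apply/cvgrPdist_le => e e0; have := hu _ e0; apply: filterS => n hn.
rewrite sub0r normrN /eps; case: ifPn => [Qn|_]; last by rewrite normr0 ltW.
have mc : 0 < 2 * m * c n by rewrite !mulr_gt0// c0.
rewrite ger0_norm ?le_max ?lexx// ge_max ltW//= lerBlDl ler_pdivrMr//.
by rewrite (_ : _ * _ = 2 * (1 + e) * m * c n) ?hn//; ring.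
Qed.

(** * Entropy rates expressed in nats *)

Section Rates.
Variables (R : realType) (d : measure_display) (Omega : measurableType d)
  (P : probability Omega R) (A : finType) (X : int -> Omega -> A).
Local Notation Pr := (Prob P).
Hypotheses (X_process : is_process X) (X_stationary : stationary P X).

Lemma rate_seq_shannon t : rate_seq P X (@shannon R A) t =
  word_entropy P X t.*2.+1 / (t.*2.+1)%:R / ln #|A|%:R.
Proof.
rewrite /rate_seq /shannon /word_entropy [RHS]mulrAC [RHS]mulrC; congr (_ * _).
rewrite mulr_suml -sumrN big_mkcond/=.
apply: eq_bigr => w _; rewrite /window_pmf (Prob_cyl X_stationary).
case: ifPn => [_|]; first by rewrite /logb; ring.
rewrite -leNgt => h; suff -> : Pr (cyl X 0 w) = 0 by rewrite mul0r mul0r.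
by apply/le_anti; rewrite h Prob_ge0.
Qed.

(** A convergent sequence is bounded, and the minimum over the support lies below each positive word
    probability. *)
Lemma neg_ln_word_le : 0 < ln #|A|%:R :> R ->
  cvgn (rate_seq P X (@renyi_minf R A)) ->
  exists C, forall t (w : {ffun 'I_t.*2.+1 -> A}), 0 < Pr (cyl X 0 w) ->
    - ln (Pr (cyl X 0 w)) <= C * (t.*2.+1)%:R.
Proof.
move=> lA /cvg_seq_bounded[B [_ hB]].
exists (ln #|A|%:R * (B + 1)) => t w pw.
have {hB} := hB (B + 1) ltac:(by rewrite ltrDl) t I.
move=> /(le_trans (ler_norm _)); rewrite /rate_seq /renyi_minf.
set m := \big[_/_]_(_ | _) _ => h.
have m0 : 0 < m by apply: lt_bigmin.
have mw : m <= Pr (cyl X 0 w).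
  rewrite -(Prob_cyl X_stationary (- t%:Z)).
  by apply: bigmin_le_cond; rewrite /window_pmf (Prob_cyl X_stationary).
apply: (@le_trans _ _ (- ln m)); first by rewrite lerN2 ler_ln ?posrE.
rewrite -ler_pdivrMr ?ltr0n// [leRHS]mulrC -ler_pdivrMr//.
by apply: le_trans h; rewrite le_eqVlt; apply/orP; left; apply/eqP; rewrite /logb; ring.
Qed.

End Rates.

(** * Rounding of the read length, and the conclusion *)

Lemma ln_nat_ge0 (R : realType) (n : nat) : 0 <= ln (n%:R : R).
Proof. by case: n => [|n]; [rewrite ln0|rewrite ln_ge0// ler1n]. Qed.

(** As floor(1/2) = 0, a positive read length forces log n > 0, the positivity that
    [vanishing_excess] asks for. *)
Lemma ell_bounds (R : realType) (A : finType) (beta : R) (n : nat) :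
  0 < beta -> 0 < ln #|A|%:R :> R ->
  (ell A beta n)%:R <= beta * logb A n%:R + 2^-1 /\
  ((0 < ell A beta n)%N -> 0 < logb A (n%:R : R)).
Proof.
move=> beta0 lA; have lb0 : 0 <= logb A (n%:R : R) by rewrite divr_ge0 ?ln_nat_ge0.
have y0 : 0 <= beta * logb A n%:R + 2^-1 by rewrite addr_ge0// mulr_ge0// ltW.
have -> : ell A beta n = Num.truncn (beta * logb A n%:R + 2^-1) by rewrite truncn_floor y0.
split; first by rewrite truncn_le.
rewrite truncn_gt0 => h; rewrite lt_neqAle lb0 andbT eq_sym; apply/eqP => E.
by move: h; rewrite E mulr0 add0r; lra.
Qed.

Theorem mainTheorem1 (R : realType) (d : measure_display) (Omega : measurableType d)
  (P : probability Omega R) (A : finType) (X : int -> Omega -> A) (beta : R) :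
  0 < beta ->
  is_process X -> stationary P X -> ergodic P X ->
  (* the entropy rates exist *)
  cvgn (rate_seq P X (@shannon R A)) ->
  (* (1): H_{-oo}(X) < oo (the limit exists and is finite) *)
  cvgn (rate_seq P X (@renyi_minf R A)) ->
  (* (2): sum_s d(s; X) < oo *)
  cvgn (series (mixing_coef P X)) ->
  (* (3): R(X) < 1 *)
  recurrence P X < 1 ->
  exists eps : nat -> R, eps @ \oo --> 0 /\
    forall n : nat, (0 < ell A beta n)%N ->
      Pstar P X n (ell A beta n) <=
        2 * (1 + eps n) * min_inv beta (lim (rate_seq P X (@shannon R A) @ \oo))
          * (@logb R A n%:R / n%:R).
Proof.
move=> beta0 Xp Xs _ cH cHm cd R1.
have := ln_nat_ge0 R #|A|; rewrite le_eqVlt => /predU1P[lA0|lA].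
  (* When ln |A| = 0 the logarithm [logb] is 0, since division by zero yields 0; all read lengths
     are then 0 and the claim is empty. *)
  exists (fun=> 0); split; first exact: cvg_cst.
  move=> n; rewrite /ell /logb -lA0 invr0 !mulr0 add0r.
  suff -> : Num.floor (2^-1 : R) = 0 by [].
  by apply/eqP; rewrite floor_eq; lra.
set H := lim _; set lA' := ln _ in lA.
have [C pC] := neg_ln_word_le Xs lA cHm.
have H0 : 0 <= H.
  apply: limr_ge => //; apply: nearW => t; rewrite rate_seq_shannon// divr_ge0 ?(ltW lA)//.
  by rewrite divr_ge0// word_entropy_ge0.
have m0 : 0 < min_inv beta H.
  rewrite /min_inv; case: eqVneq => // Hn0.
  by rewrite lt_min beta0 invr_gt0 lt_neqAle eq_sym Hn0.
apply: vanishing_excess => // [n en|e e0].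
  have lb := (ell_bounds n beta0 lA).2 en; rewrite divr_gt0// ltr0n lt0n; apply/eqP => nE.
  by move: lb; rewrite nE /logb ln0// mul0r ltxx.
have dm0 s : 0 <= mixing_coef P X s by exact: mixing_coef_ge0.
have [D dD] : exists D, forall n, \sum_(s < n) mixing_coef P X s <= D.
  exists (limn (series (mixing_coef P X))) => n.
  rewrite -(big_mkord xpredT (mixing_coef P X)).
  apply: (nondecreasing_cvgn_le _ cd); apply: nondecreasing_series => i _ _.
  exact: dm0.
pose b := beta / lA'.
have b0 : 0 < b by rewrite divr_gt0.
(* The relative slack e, turned into an additive slack on the coefficient of ln n. *)
pose eta := 2 * e * min_inv beta H / lA'.
have eta0 : 0 < eta by rewrite divr_gt0// !mulr_gt0.
suff [x0 hx0] : exists x0 : R, forall n : nat, x0 <= ln n%:R -> (0 < ell A beta n)%N ->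
    n%:R * Pstar P X n (ell A beta n) <= (2 * (min_inv beta H / lA') + eta) * ln n%:R.
  near=> n => en.
  have n0 : (0 : R) < n%:R by rewrite ltr0n; near: n; exact: nbhs_infty_gt.
  rewrite -(ler_pM2l n0).
  have -> : n%:R * (2 * (1 + e) * min_inv beta H * (logb A n%:R / n%:R)) =
     (2 * (min_inv beta H / lA') + eta) * ln n%:R.
    by rewrite /eta /logb -/lA'; field; rewrite !gt_eqF.
  apply: hx0 => //; rewrite -[leLHS]expRK ler_ln ?posrE ?expR_gt0//.
  by near: n; exact: nbhs_infty_ger.
have lE n : b * ln n%:R = beta * logb A n%:R by rewrite /b /logb -/lA'; ring.
(* Serves both H = 0 and beta <= 1/H: 2 l <= 2 b ln n + 1, and 1 <= eta ln n from the threshold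
   on. *)
have trivial_case : exists x0 : R, forall n : nat, x0 <= ln n%:R -> (0 < ell A beta n)%N ->
    n%:R * Pstar P X n (ell A beta n) <= (2 * b + eta) * ln n%:R.
  exists eta^-1 => n nx en; apply: (le_trans (Pstar_trivial P Xp n en)).
  have := (ell_bounds n beta0 lA).1; rewrite -lE.
  move: nx; rewrite -[leLHS]mul1r ler_pdivrMr//; move: (ln _) => x; lra.
rewrite /min_inv; case: eqVneq => [_|Hn0]; first exact: trivial_case.
case: (leP beta H^-1) => _; first exact: trivial_case.
have Hp : 0 < H by rewrite lt_neqAle eq_sym Hn0.
(* The rate H is in base |A|; in nats it becomes [H * lA']. *)
have hlim : (fun t => word_entropy P X t.*2.+1 / (t.*2.+1)%:R) @ \oo --> H * lA'.
  have -> : (fun t => word_entropy P X t.*2.+1 / (t.*2.+1)%:R) =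
      (fun t => rate_seq P X (@shannon R A) t * lA').
    by apply/funext => t; rewrite rate_seq_shannon// -/lA' divfK// gt_eqF.
  by apply: cvgM; [exact: cH|exact: cvg_cst].
have [x0 hx0] := Pstar_detector_asymptotic Xp Xs (mulr_gt0 Hp lA) b0 eta0 R1
  (cvg_series_cvg_0 cd) dD hlim pC.
exists x0 => n nx en.
apply: (le_trans (hx0 n _ nx en _)).
  by rewrite lE; have := (ell_bounds n beta0 lA).1; lra.
by rewrite (_ : 2 / (H * lA') = 2 * (H^-1 / lA'))//; field; rewrite !gt_eqF.
Unshelve. all: by end_near.
Qed.
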